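(* Let $H$ be a complex Hilbert space, let $A,B\in B^{++}(H)$, let $n\in\mathbb{N}$ with $n\ge2$, and let $v\in\mathbb{R}$ with $v\ne\frac12$. (i) If $v\notin\left[\frac12,\frac{2^{n-1}+1}{2^n}\right]$, then $$A\nabla_v B\le A\natural_v B+2(1-v)\left(A\nabla B-A\sharp B\right)+(2v-1)\sum_{k=2}^n 2^{k-2}\left(A\sharp B-2\,A\sharp_{\frac{2^{k-1}+1}{2^k}}B+A\sharp_{\frac{2^{k-2}+1}{2^{k-1}}}B\right).$$ (ii) If $v\notin\left[\frac{2^{n-1}-1}{2^n},\frac12\right]$, then $$A\nabla_v B\le A\natural_v B+2v\left(A\nabla B-A\sharp B\right)+(1-2v)\sum_{k=2}^n 2^{k-2}\left(A\sharp B-2\,A\sharp_{\frac{2^{k-1}-1}{2^k}}B+A\sharp_{\frac{2^{k-2}-1}{2^{k-1}}}B\right).$$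
   Context: $B(H)$ is the algebra of bounded linear operators on the complex Hilbert space $H$. A self-adjoint $T\in B(H)$ is positive, written $T\ge0$, if $\langle Tx,x\rangle\ge0$ for all $x\in H$; $S\le T$ means $T-S\ge0$. $B^{++}(H)$ is the set of positive invertible operators in $B(H)$. For $A,B\in B^{++}(H)$ and $v\in\mathbb{R}$, set $A\nabla_v B=(1-v)A+vB$ and $A\natural_v B=A^{1/2}\left(A^{-1/2}BA^{-1/2}\right)^vA^{1/2}$ (real powers via continuous functional calculus). For $v\in[0,1]$ the operator $A\natural_v B$ is written $A\sharp_v B$. Further, $A\nabla B=A\nabla_{1/2}B=\frac{A+B}{2}$ and $A\sharp B=A\sharp_{1/2}B$. *)

(* Defs.v *)
From HB Require Import structures.
From mathcomp Require Import all_boot all_order all_algebra.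
From mathcomp Require Import complex.
From mathcomp Require Import all_classical all_reals all_analysis.

Set Implicit Arguments.
Unset Strict Implicit.
Unset Printing Implicit Defensive.

Import Order.TTheory GRing.Theory Num.Theory.
Import numFieldNormedType.Exports.

Local Open Scope classical_set_scope.
Local Open Scope complex_scope.
Local Open Scope ring_scope.

(* The inner product is linear in its first argument, conjugate-linear in its
   second one, and induces the norm of the underlying Banach space. *)
HB.mixin Record NormedModule_isPreHilbert (R : realType) (H : Type)
    of NormedModule R[i] H := {
  inner : {dot H for (@Num.conj R[i])} ;
  inner_norm : forall x : H, `|x| ^+ 2 = inner x x
}.

#[short(type="hilbertType")]
HB.structure Definition Hilbert (R : realType) :=
  {H of CompleteNormedModule R[i] H & NormedModule_isPreHilbert R H}.

Section BoundedOperators.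
Context {R : realType} (H : hilbertType R).

(* B(H): for linear maps, bounded and continuous are the same
   (linear_bounded_continuous). *)
Record bounded_op := BoundedOp {
  op_fun :> H -> H ;
  op_linear : linear op_fun ;
  op_continuous : continuous op_fun
}.

HB.instance Definition _ := gen_eqMixin bounded_op.
HB.instance Definition _ := gen_choiceMixin bounded_op.

HB.instance Definition _ (T : bounded_op) :=
  GRing.isLinear.Build R[i] H H *:%R (op_fun T) (op_linear T).

Lemma bounded_op_ext (S T : bounded_op) : S =1 T -> S = T.
Proof.
case: S T => [f fl fc] [g gl gc] /= /funext fg; subst g.
by congr BoundedOp; exact: Prop_irrelevance.
Qed.


Lemma zero_op_linear : linear (cst 0 : H -> H).
Proof. by move=> a x y; rewrite /= scaler0 addr0. Qed.

Definition zero_op : bounded_op :=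
  BoundedOp zero_op_linear (fun=> @cvg_cst _ _ _ _ _).

Lemma opp_op_linear (T : bounded_op) : linear (fun x => - T x).
Proof. by move=> a x y; rewrite linearP opprD scalerN. Qed.

Lemma opp_op_continuous (T : bounded_op) : continuous (fun x => - T x).
Proof. by move=> x; apply: cvgN; exact: op_continuous. Qed.

Definition opp_op (T : bounded_op) : bounded_op :=
  BoundedOp (opp_op_linear T) (@opp_op_continuous T).

Lemma add_op_linear (S T : bounded_op) : linear (fun x => S x + T x).
Proof. by move=> a x y; rewrite !linearP scalerDr addrACA. Qed.

Lemma add_op_continuous (S T : bounded_op) : continuous (fun x => S x + T x).
Proof. by move=> x; apply: cvgD; exact: op_continuous. Qed.

Definition add_op (S T : bounded_op) : bounded_op :=
  BoundedOp (add_op_linear S T) (@add_op_continuous S T).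

Lemma id_op_linear : linear (fun x : H => x).
Proof. by []. Qed.

Definition id_op : bounded_op := BoundedOp id_op_linear (fun=> cvg_id).

Lemma comp_op_linear (S T : bounded_op) : linear (fun x => S (T x)).
Proof. by move=> a x y; rewrite !linearP. Qed.

Lemma comp_op_continuous (S T : bounded_op) : continuous (fun x => S (T x)).
Proof. by move=> x; apply: continuous_comp; exact: op_continuous. Qed.

Definition comp_op (S T : bounded_op) : bounded_op :=
  BoundedOp (comp_op_linear S T) (@comp_op_continuous S T).

Lemma scale_op_linear (a : R[i]) (T : bounded_op) : linear (fun x => a *: T x).
Proof. by move=> b x y; rewrite linearP scalerDr !scalerA mulrC. Qed.

Lemma scale_op_continuous (a : R[i]) (T : bounded_op) :
  continuous (fun x => a *: T x).
Proof. by move=> x; apply: cvgZr; exact: op_continuous. Qed.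

Definition scale_op (a : R[i]) (T : bounded_op) : bounded_op :=
  BoundedOp (scale_op_linear a T) (@scale_op_continuous a T).

Lemma add_opA : associative add_op.
Proof. by move=> S T U; apply: bounded_op_ext => x /=; rewrite addrA. Qed.

Lemma add_opC : commutative add_op.
Proof. by move=> S T; apply: bounded_op_ext => x /=; rewrite addrC. Qed.

Lemma add_0op : left_id zero_op add_op.
Proof. by move=> T; apply: bounded_op_ext => x /=; rewrite add0r. Qed.

Lemma add_Nop : left_inverse zero_op opp_op add_op.
Proof. by move=> T; apply: bounded_op_ext => x /=; rewrite addNr. Qed.

HB.instance Definition _ :=
  GRing.isZmodule.Build bounded_op add_opA add_opC add_0op add_Nop.

Lemma comp_opA : associative comp_op.
Proof. by move=> S T U; exact: bounded_op_ext. Qed.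

Lemma comp_1op : left_id id_op comp_op.
Proof. by move=> T; exact: bounded_op_ext. Qed.

Lemma comp_op1 : right_id id_op comp_op.
Proof. by move=> T; exact: bounded_op_ext. Qed.

Lemma comp_opDl : left_distributive comp_op +%R.
Proof. by move=> S T U; exact: bounded_op_ext. Qed.

Lemma comp_opDr : right_distributive comp_op +%R.
Proof. by move=> S T U; apply: bounded_op_ext => x /=; rewrite linearD. Qed.

(* Not a nontrivial ring in general: H may be the zero space. *)
HB.instance Definition _ := GRing.Zmodule_isPzRing.Build bounded_op
  comp_opA comp_1op comp_op1 comp_opDl comp_opDr.

Lemma scale_opA (a b : R[i]) (T : bounded_op) :
  scale_op a (scale_op b T) = scale_op (a * b) T.
Proof. by apply: bounded_op_ext => x /=; rewrite scalerA. Qed.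

Lemma scale_1op : left_id 1 scale_op.
Proof. by move=> T; apply: bounded_op_ext => x /=; rewrite scale1r. Qed.

Lemma scale_opDr : right_distributive scale_op +%R.
Proof. by move=> a S T; apply: bounded_op_ext => x /=; rewrite scalerDr. Qed.

Lemma scale_opDl (T : bounded_op) : {morph scale_op^~ T : a b / a + b}.
Proof. by move=> a b; apply: bounded_op_ext => x /=; rewrite scalerDl. Qed.

HB.instance Definition _ := GRing.Zmodule_isLmodule.Build R[i] bounded_op
  scale_opA scale_1op scale_opDr scale_opDl.

End BoundedOperators.

Notation "''B(' H )" := (bounded_op H) (format "''B(' H )") : type_scope.

Section FunctionalCalculus.
Context {R : realType} {H : hilbertType R}.
Implicit Types (S T : 'B(H)) (f : R -> R) (p : {poly R}).

Definition self_adjoint T := forall x y : H, inner (T x) y = inner x (T y).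

(* 0 <= z in R[i] means that z is a nonnegative real. *)
Definition positive_op T :=
  self_adjoint T /\ forall x : H, 0 <= inner (T x) x.

Definition le_op S T := positive_op (T - S).

Definition invertible_op T := exists S, S * T = 1 /\ T * S = 1.

Definition pos_inv_op T := positive_op T /\ invertible_op T.

Definition spectrum T : set R[i] :=
  [set z | ~ invertible_op (T - z *: (1 : 'B(H)))].

Definition horner_op p T : 'B(H) := \sum_(i < size p) (p`_i)%:C *: T ^+ i.

(* Continuous functional calculus of a self-adjoint operator T (so that the
   spectrum is real) for a function f that is real-valued and continuous on the
   spectrum: f(T) is the limit in operator norm of p_n(T) for polynomials p_n
   that converge to f uniformly on the spectrum of T. *)
Definition is_cfc f T S :=
  exists p : nat -> {poly R}, forall e : R, 0 < e -> \forall n \near \oo,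
    (forall t : R, spectrum T t%:C -> `|(p n).[t] - f t| <= e) /\
    (forall x : H, `|horner_op (p n) T x - S x| <= e%:C * `|x|).

(* Junk value 0 if there is no such limit. *)
Definition cfc f T : 'B(H) := xget 0 (is_cfc f T).

Definition pow_op T (v : R) : 'B(H) := cfc (fun t => t `^ v) T.

Definition arith_mean (v : R) A B : 'B(H) := (1 - v)%:C *: A + v%:C *: B.

Definition geom_mean (v : R) A B : 'B(H) :=
  pow_op A 2^-1 *
  pow_op (pow_op A (- 2^-1) * B * pow_op A (- 2^-1)) v *
  pow_op A 2^-1.

End FunctionalCalculus.

Notation "S <=o T" := (le_op S T) (at level 70, no associativity).
Notation "A ∇_[ v ] B" := (arith_mean v A B)
  (at level 45, v at level 200, no associativity, format "A  ∇_[ v ]  B").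
Notation "A ∇ B" := (arith_mean 2^-1 A B) (at level 45, no associativity).
Notation "A ♮_[ v ] B" := (geom_mean v A B)
  (at level 45, v at level 200, no associativity, format "A  ♮_[ v ]  B").
(* For weights in [0, 1], the usual name of the same operator. *)
Notation "A ♯_[ v ] B" := (geom_mean v A B)
  (at level 45, v at level 200, no associativity, only parsing).
Notation "A ♯ B" := (geom_mean 2^-1 A B) (at level 45, no associativity).

(* Main.v *)
From HB Require Import structures.
Require Import Defs.
From mathcomp Require Import all_boot all_order all_algebra.
From mathcomp Require Import complex.
From mathcomp Require Import all_classical all_reals all_analysis.
From mathcomp Require Import ring lra.

Set Implicit Arguments.
Unset Strict Implicit.
Unset Printing Implicit Defensive.

Import Order.TTheory GRing.Theory Num.Theory.
Import numFieldNormedType.Exports.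

Local Open Scope complex_scope.
Local Open Scope ring_scope.

(** Write C = A^(1/2), D = A^(-1/2) and X = D B D, a positive invertible
    operator.  The congruence S |-> C S C is linear, preserves positivity, and
    sends 1 to A, X to B and X^r to the mean of A and B of weight r.  Each
    inequality is therefore the image of an inequality between functions of
    the single operator X, and by the functional calculus it is enough to
    prove it for a real number t > 0 in place of X.

    Both scalar inequalities are one statement with a sign sgn = 1 or -1
    ([refined_young]): put d = sgn (2 v - 1) and let the k-th weight be
    g k = 1/2 + sgn / 2^k.  The sum telescopes, the linear terms cancel
    because g 1 is 1 or 0, and after division by the square root of t what
    remains is Bernoulli's inequality 1 + c (y - 1) <= y^c with
    y = t^(sgn / 2^n) and c = 2^(n-1) d.  It holds unless 0 < c < 1, and
    then v is inside the interval that the hypothesis excludes.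

    The bulk of the file develops the functional calculus.  It rests on
    [horner_op_positive]: if T is self-adjoint and the real polynomial p is
    nonnegative on the spectrum of T, then p(T) is positive.  The proof has
    two halves.
    - A self-adjoint operator with nonnegative real spectrum is positive
      ([positive_of_spectrum]), because the infimum m of its numerical range
      is in the spectrum: T - m is positive, and a positive invertible
      operator is bounded below by a positive constant.
    - The spectrum of p(T) is controlled by that of T
      ([cpoly_op_invertible]): split p - mu into linear factors over the
      complex numbers; if no root is in the spectrum of T, all factors are
      invertible.  Only real roots matter, as the spectrum of T is real
      ([spectrum_real]).
    Applied to e^2 - p^2, positivity bounds the norm of p(T) by the supremum
    of |p| on the spectrum.  Hence p_n(T) converges as soon as p_n converges
    uniformly there, the limit does not depend on the sequence, and it is
    additive, multiplicative and monotone in the limit function.  For real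
    powers the approximating polynomials are Bernstein polynomials
    ([weierstrass_lipschitz]), which suffice because t^v is Lipschitz on
    every segment of positive numbers. *)

(** * The scalar inequality *)

Section ScalarInequality.
Context {R : realType}.
Implicit Types (a b c t v : R).

(** With y = exp L, both cases follow from the tangent inequality
    exp b (1 + (a - b)) <= exp a: at b = 0 if c <= 0, and at b = L, tested
    against a = c L and a = 0, if 1 <= c. *)
Lemma bernoulli_powR y c : 0 < y -> c <= 0 \/ 1 <= c -> 1 + c * (y - 1) <= y `^ c.
Proof.
move=> y0 hc; rewrite /powR gt_eqF//.
have tangent a b : expR b * (1 + (a - b)) <= expR a.
  by rewrite -[in leRHS](subrK b a) expRD mulrC ler_wpM2r ?expR_ge0 ?expR_ge1Dx.
move: (ln y) (lnK y0) => L <-.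
case: hc => hc.
  have := expR_ge1Dx L; have := expR_ge1Dx (c * L); nra.
have := tangent 0 L; have := tangent (c * L) L.
have := expR_gt0 L; rewrite expR0; move: (expR L) => E E0 h1 h2.
by nra.
Qed.

(** Writing u k = 2^(k-1) (s - g k), the k-th term is u k - u (k-1). *)
Lemma telescope_means (s : R) (g : nat -> R) n : (0 < n)%N ->
  \sum_(2 <= k < n.+1) 2 ^+ (k - 2) * (s - 2 * g k + g k.-1) =
  (2 ^+ n.-1 - 1) * s + g 1%N - 2 ^+ n.-1 * g n.
Proof.
elim: n => [//|[|n] IH] _; first by rewrite big_geq// expr0; ring.
rewrite big_nat_recr //= IH //= subSS subn1 /= exprS; ring.
Qed.

(** For sgn = 1 and sgn = -1 this is the numerical form of the two operator
    inequalities, with A = 1 and B = t. *)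
Lemma refined_young t v sgn n (d := sgn * (2 * v - 1))
    (g := fun k => 2^-1 + sgn / 2 ^+ k) :
  0 < t -> sgn = 1 \/ sgn = -1 -> (0 < n)%N ->
  d * 2 ^+ n.-1 <= 0 \/ 1 <= d * 2 ^+ n.-1 ->
  (1 - v) + v * t <= t `^ v + (1 - d) * ((1 - 2^-1) + 2^-1 * t - t `^ 2^-1)
    + d * \sum_(2 <= k < n.+1)
        2 ^+ (k - 2) * (t `^ 2^-1 - 2 * t `^ (g k) + t `^ (g k.-1)).
Proof.
move=> t0 hs n0 hc.
rewrite (telescope_means _ (fun k => t `^ (g k))) //=.
set c := d * 2 ^+ n.-1 in hc *.
have tn0 : t != 0 by rewrite gt_eqF.
have e1 : t `^ g n = t `^ 2^-1 * t `^ (sgn / 2 ^+ n).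
  by rewrite -powRD // tn0 implybT.
have p2 : (2 : R) ^+ n.-1 != 0 by rewrite expf_neq0.
have e2 : t `^ v = t `^ 2^-1 * (t `^ (sgn / 2 ^+ n)) `^ c.
  rewrite -powRrM -powRD ?tn0 ?implybT //; congr (_ `^ _).
  rewrite /c /d -(prednK n0) [n.-1.+1.-1]/= exprS.
  by case: hs => ->; field.
have e3 : (1 - d) * (1 + t) / 2 + d * t `^ g 1%N = 1 - v + v * t.
  rewrite /d /g expr1; case: hs => ->.
    have -> : 2^-1 + 1 / 2 = 1 :> R by field.
    by rewrite powRr1 ?ltW//; field.
  have -> : 2^-1 + -1 / 2 = 0 :> R by field.
  by rewrite powRr0; field.
have B := bernoulli_powR (powR_gt0 (sgn / 2 ^+ n) t0) hc.
have s0 := powR_gt0 2^-1 t0.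
rewrite e1 -e3 e2.
move: B s0 e3 => /[swap] s0 /(ler_wpM2l (ltW s0)); rewrite /c.
set s := t `^ 2^-1; set y := t `^ (sgn / _).
set z := y `^ _; set w := t `^ g _; set p := 2 ^+ n.-1.
lra.
Qed.
End ScalarInequality.

(** * Polynomial approximation *)

Section Weierstrass.
Context {R : realType}.
Implicit Types (a b c x : R) (g h : nat -> R).

(** The Bernstein polynomial with sum g(k) C(n,k) X^k (1-X)^(n-k), in
    the form given by de Casteljau's algorithm.  The recursion yields
    monotonicity and the second moment by induction, with no binomial identity. *)
Fixpoint bernstein n g : {poly R} :=
  if n is m.+1 then
    (1 - 'X) * bernstein m g + 'X * bernstein m (g \o succn)
  else (g 0%N)%:P.

Lemma bernsteinS n g x : (bernstein n.+1 g).[x] =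
  (1 - x) * (bernstein n g).[x] + x * (bernstein n (g \o succn)).[x].
Proof. by rewrite /= !hornerE. Qed.

Lemma bernstein_le n g h x : 0 <= x <= 1 -> (forall k, (k <= n)%N -> g k <= h k) ->
  (bernstein n g).[x] <= (bernstein n h).[x].
Proof.
move=> /andP[x0 x1]; elim: n g h => [|n IH] g h gh.
  by rewrite !hornerC gh.
rewrite !bernsteinS lerD// ler_wpM2l ?subr_ge0//; apply: IH => k kn.
  by rewrite gh // ltnW.
by rewrite /= gh.
Qed.

(** Mean and variance of the binomial distribution in one formula. *)
Lemma bernstein_quadratic n a b c x :
  (bernstein n (fun k => a + b * (k%:R - c) ^+ 2)).[x] =
  a + b * (n%:R * x * (1 - x) + (n%:R * x - c) ^+ 2).
Proof.
elim: n c => [|n IH] c; first by rewrite hornerC; ring.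
rewrite bernsteinS IH.
have -> : (fun k => a + b * (k%:R - c) ^+ 2) \o succn =
    fun k : nat => a + b * (k%:R - (c - 1)) ^+ 2.
  by apply/funext => k /=; rewrite -natr1; ring.
by rewrite IH -natr1; ring.
Qed.

(** Sample f at the points k / N.  For every r > 0,
    |k/N - x| <= r + (k/N - x)^2 / r, so that the values f(k/N) lie between
    f x - q k and f x + q k for a quadratic polynomial q in k.  The Bernstein
    polynomials of q are known, and q contributes L r + L x (1-x) / (r N). *)
Lemma weierstrass01 (f : R -> R) (L e : R) : 0 < e ->
  (forall x y, 0 <= x <= 1 -> 0 <= y <= 1 -> `|f x - f y| <= L * `|x - y|) ->
  exists p : {poly R}, forall x, 0 <= x <= 1 -> `|p.[x] - f x| <= e.
Proof.
move=> e0 fL.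
have L0 : 0 <= L.
  have := fL 1 0; rewrite subr0 normr1 mulr1 !lexx ler01 => /(_ isT isT).
  exact: le_trans.
pose r := e / (2 * (L + 1)).
have r0 : 0 < r by rewrite divr_gt0 // mulr_gt0 // ltr_wpDl.
(* This makes the variance term L x (1 - x) / (r N) at most L r. *)
have [n nP] : exists n : nat, r ^- 2 <= n.+1%:R.
  exists (Num.Def.truncn (r ^- 2)); apply: ltW; exact: truncnS_gt.
exists (bernstein n.+1 (fun k => f (k%:R / n.+1%:R))) => x x01.
have N0 : 0 < n.+1%:R :> R by rewrite ltr0n.
set N : R := n.+1%:R in nP N0 *.
have sampling k : (k <= n.+1)%N ->
    `|f (k%:R / N) - f x| <= L * r + L / (r * N ^+ 2) * (k%:R - N * x) ^+ 2.
  move=> kn.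
  have k01 : 0 <= k%:R / N <= 1.
    apply/andP; split; first by rewrite divr_ge0 ?ler0n// ltW.
    by rewrite ler_pdivrMr // mul1r ler_nat.
  apply: le_trans (fL _ _ k01 x01) _.
  have -> : L * r + L / (r * N ^+ 2) * (k%:R - N * x) ^+ 2 =
      L * (r + `|k%:R / N - x| ^+ 2 / r).
    by rewrite real_normK ?num_real//; field; rewrite !gt_eqF.
  rewrite ler_wpM2l//; set u := `|_|.
  have u0 : 0 <= u := normr_ge0 _.
  by rewrite -(ler_pM2r r0) mulrDl divfK ?gt_eqF//; nra.
have main : L * r + L / (r * N ^+ 2) * (N * x * (1 - x) + (N * x - N * x) ^+ 2) <= e.
  have -> : L * r + L / (r * N ^+ 2) * (N * x * (1 - x) + (N * x - N * x) ^+ 2) =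
     L * r + L * r * (r ^- 2 / N) * (x * (1 - x)) by field; rewrite !gt_eqF.
  have h1 : r ^- 2 / N * (x * (1 - x)) <= 1.
    have a1 : r ^- 2 / N <= 1 by rewrite ler_pdivrMr // mul1r.
    have a0 : 0 <= r ^- 2 / N by rewrite divr_ge0 ?invr_ge0 ?exprn_ge0// ltW.
    case/andP: x01 => x0 x1; apply: mulr_ile1 => //; last by nra.
    by rewrite mulr_ge0 ?subr_ge0.
  have h2 : L * r * 2 <= e.
    have -> : L * r * 2 = e * (L / (L + 1)).
      by rewrite /r; field; rewrite gt_eqF // ltr_wpDl.
    by rewrite -[leRHS]mulr1 ler_wpM2l ?ltW // ltr_pdivrMr ?ltr_wpDl//; lra.
  have h3 : 0 <= L * r by rewrite mulr_ge0 // ltW.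
  rewrite -(mulrA (L * r)); move: h1 h2 h3.
  by move: (L * r) (r ^- 2 / N * _) => u w; nra.
rewrite ler_norml; apply/andP; split.
- have := @bernstein_le n.+1
    (fun k => (f x - L * r) + - (L / (r * N ^+ 2)) * (k%:R - N * x) ^+ 2)
    (fun k => f (k%:R / N)) x x01.
  rewrite bernstein_quadratic -/N => H.
  suff: f x - e <= (bernstein n.+1 (fun k => f (k%:R / N))).[x] by lra.
  apply: le_trans (H _).
    by rewrite mulNr; move: main; move: (L / _ * _) (L * r) => u w; lra.
  by move=> k kn; have := sampling k kn; rewrite ?mulNr ler_norml => /andP[];
    move: (L / _ * _) (L * r) => u w; lra.
- rewrite lerBlDr.
  have := @bernstein_le n.+1 (fun k => f (k%:R / N))
    (fun k => (f x + L * r) + (L / (r * N ^+ 2)) * (k%:R - N * x) ^+ 2) x x01.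
  rewrite bernstein_quadratic => H.
  apply: le_trans (H _) _ => [k kn|].
    by have := sampling k kn; rewrite ?mulNr ler_norml => /andP[];
    move: (L / _ * _) (L * r) => u w; lra.
  rewrite -/N; move: main; move: (L / _ * _) (L * r) => u w; lra.
Qed.

Lemma weierstrass_lipschitz (f : R -> R) (a b L e : R) : a < b -> 0 < e ->
  (forall x y, a <= x <= b -> a <= y <= b -> `|f x - f y| <= L * `|x - y|) ->
  exists p : {poly R}, forall x, a <= x <= b -> `|p.[x] - f x| <= e.
Proof.
move=> ab e0 fL; have ba : 0 < b - a by rewrite subr_gt0.
have [|p pP] := @weierstrass01 (fun s => f (a + (b - a) * s)) (L * (b - a)) e e0.
  move=> x y x01 y01; apply: le_trans (fL _ _ _ _) _; [nra|nra|].
  have -> : a + (b - a) * x - (a + (b - a) * y) = (b - a) * (x - y) by ring.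
  by rewrite normrM (gtr0_norm ba) mulrA.
exists (p \Po ((b - a)^-1 *: ('X - a%:P))) => x xab.
rewrite horner_comp !hornerE.
have -> : f x = f (a + (b - a) * ((b - a)^-1 * (x - a))).
  by congr f; field; rewrite gt_eqF.
apply: pP; rewrite mulr_ge0 ?invr_ge0 ?(ltW ba)//=; last by lra.
by rewrite mulrC ler_pdivrMr// mul1r; lra.
Qed.

(** t^v = exp (v ln t), where ln is Lipschitz with constant 1/a on [a, b] and
    exp is Lipschitz on bounded sets. *)
Lemma powR_lipschitz (a b v : R) : 0 < a -> exists L : R, forall x y,
  a <= x <= b -> a <= y <= b -> `|x `^ v - y `^ v| <= L * `|x - y|.
Proof.
move=> a0; exists (expR (`|v| * (`|ln a| + `|ln b|)) * (`|v| / a)).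
set K := expR _.
have ln_sub x y : 0 < x -> a <= y -> ln x - ln y <= a^-1 * `|x - y|.
  move=> x0 ay; have y0 : 0 < y := lt_le_trans a0 ay.
  rewrite -ln_div ?posrE//; apply: (@le_trans _ _ ((x - y) / y)).
    have := @le_ln1Dx R ((x - y) / y); rewrite mulrBl divff ?gt_eqF//.
    by rewrite subrKC; apply; rewrite ltrBrDl subrr divr_gt0.
  apply: (@le_trans _ _ (`|x - y| / y)).
    by rewrite ler_wpM2r ?invr_ge0 ?ler_norm// ltW.
  by rewrite mulrC ler_wpM2r// lef_pV2 ?posrE.
have half x y : a <= x <= b -> a <= y <= b ->
    x `^ v - y `^ v <= K * (`|v| / a) * `|x - y|.
  move=> xab yab.
  have /andP[ax xb] := xab; have /andP[ay yb] := yab.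
  have x0 : 0 < x by apply: lt_le_trans ax.
  have y0 : 0 < y by apply: lt_le_trans ay.
  rewrite /powR !gt_eqF//.
  set u := v * ln x; set w := v * ln y.
  have h1 : expR u - expR w <= expR u * `|u - w|.
    have : expR u * (1 + (w - u)) <= expR w.
      by rewrite -[in leRHS](subrKC u w) expRD ler_wpM2l ?expR_ge0 ?expR_ge1Dx.
    have := ler_wpM2l (expR_ge0 u) (ler_norm (u - w)); lra.
  apply: le_trans h1 _; rewrite -!mulrA; apply: ler_pM; rewrite ?expR_ge0//.
    rewrite ler_expR; apply: le_trans (ler_norm _) _.
    rewrite normrM ler_wpM2l// ler_norml.
    have : ln a <= ln x by rewrite ler_ln ?posrE.
    have : ln x <= ln b by rewrite ler_ln ?posrE// (lt_le_trans x0).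
    have := ler_norm (ln b); have := ler_norm (- ln a); rewrite normrN.
    have := normr_ge0 (ln a); have := normr_ge0 (ln b); lra.
  rewrite -mulrBr normrM ler_wpM2l// ler_norml.
  have := ln_sub _ _ x0 ay; have := ln_sub _ _ y0 ax; rewrite distrC; lra.
move=> x y xab yab; rewrite ler_norml.
have := half _ _ xab yab; have := half _ _ yab xab; rewrite distrC; lra.
Qed.
End Weierstrass.

(** * The underlying real Hilbert space *)

Section RealHilbert.
Context {R : realType} {H : hilbertType R}.
Implicit Types (x y z : H) (r : R).

Lemma Re_conj (z : R[i]) : complex.Re (Num.conj z) = complex.Re z.
Proof. by case: z. Qed.

Lemma Im_conj_eq0 (z : R[i]) : z = Num.conj z -> complex.Im z = 0.
Proof. by case: z => a b [/eqP]; rewrite -addr_eq0 -mulr2n mulrn_eq0 => /eqP. Qed.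

Lemma ReD (z w : R[i]) : complex.Re (z + w) = complex.Re z + complex.Re w.
Proof. by case: z; case: w. Qed.

Lemma ReN (z : R[i]) : complex.Re (- z) = - complex.Re z.
Proof. by case: z. Qed.

Lemma ReZ r (z : R[i]) : complex.Re (r%:C * z) = r * complex.Re z.
Proof. by case: z => a b /=; rewrite mul0r subr0. Qed.

(** The norm and the scalar product take values in the complex numbers, which
    are only partially ordered.  Their real parts [rnorm] and [rinner] make H
    a real Hilbert space with the same norm, and keep estimates in the ordered
    field R. *)
Definition rinner x y : R := complex.Re (inner x y).
Definition rnorm x : R := complex.Re `|x|.

Lemma rnormE x : `|x| = (rnorm x)%:C.
Proof. by rewrite RRe_real // normr_real. Qed.

Lemma rnorm_ge0 x : 0 <= rnorm x.
Proof. by rewrite -ler0c -rnormE normr_ge0. Qed.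

Lemma rnormD x y : rnorm (x + y) <= rnorm x + rnorm y.
Proof. by rewrite -lecR rmorphD /= -!rnormE ler_normD. Qed.

Lemma rnormN x : rnorm (- x) = rnorm x.
Proof. by rewrite /rnorm normrN. Qed.

Lemma rdistC x y : rnorm (x - y) = rnorm (y - x).
Proof. by rewrite -rnormN opprB. Qed.

Lemma rnormZ r x : rnorm (r%:C *: x) = `|r| * rnorm x.
Proof.
apply: complexI; rewrite -rnormE normrZ rmorphM /= -rnormE; congr (_ * _).
by rewrite normc_def /= expr0n /= addr0 sqrtr_sqr.
Qed.

Lemma rnorm_eq0 x : (rnorm x == 0) = (x == 0).
Proof. by rewrite -[x == 0]normr_eq0 rnormE (inj_eq (@complexI R)). Qed.

Lemma rnorm0 : rnorm (0 : H) = 0.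
Proof. by apply/eqP; rewrite rnorm_eq0. Qed.

Lemma rnorm_sqr x : rnorm x ^+ 2 = rinner x x.
Proof.
apply: complexI; rewrite rmorphXn /= -rnormE inner_norm /rinner RRe_real //.
by rewrite -inner_norm rpredX ?normr_real.
Qed.

Lemma rinnerC x y : rinner x y = rinner y x.
Proof. by rewrite /rinner hermC expr0 mul1r; exact: Re_conj. Qed.

Lemma rinnerDl x y z : rinner (x + y) z = rinner x z + rinner y z.
Proof. by rewrite /rinner linearDl ReD. Qed.

Lemma rinnerDr x y z : rinner z (x + y) = rinner z x + rinner z y.
Proof. by rewrite !(rinnerC z) rinnerDl. Qed.

Lemma rinnerZl r x z : rinner (r%:C *: x) z = r * rinner x z.
Proof. by rewrite /rinner linearZl_LR ReZ. Qed.

Lemma rinnerZr r x z : rinner z (r%:C *: x) = r * rinner z x.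
Proof. by rewrite !(rinnerC z) rinnerZl. Qed.

Lemma rinnerNl x z : rinner (- x) z = - rinner x z.
Proof. by rewrite /rinner linearNl ReN. Qed.

Lemma rinnerNr x z : rinner z (- x) = - rinner z x.
Proof. by rewrite !(rinnerC z) rinnerNl. Qed.

Lemma rinner0l z : rinner 0 z = 0.
Proof. by rewrite -(subrr z) rinnerDl rinnerNl subrr. Qed.

Lemma rinner0r z : rinner z 0 = 0.
Proof. by rewrite rinnerC rinner0l. Qed.

Definition rinnerE := (rinnerDl, rinnerDr, rinnerNl, rinnerNr, rinnerZl, rinnerZr).

(** Cauchy-Schwarz: expand the square of the norm of |y| x - |x| y. *)
Lemma rinner_le x y : rinner x y <= rnorm x * rnorm y.
Proof.
have [->|x0] := eqVneq x 0.
  by rewrite rinner0l mulr_ge0 ?rnorm_ge0.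
have [->|y0] := eqVneq y 0.
  by rewrite rinner0r mulr_ge0 ?rnorm_ge0.
have := sqr_ge0 (rnorm ((rnorm y)%:C *: x - (rnorm x)%:C *: y)).
rewrite rnorm_sqr !rinnerE -!rnorm_sqr (rinnerC y x) => h.
have a0 : 0 < rnorm x by rewrite lt_def rnorm_eq0 x0 rnorm_ge0.
have b0 : 0 < rnorm y by rewrite lt_def rnorm_eq0 y0 rnorm_ge0.
rewrite -(ler_pM2l (mulr_gt0 a0 b0)); lra.
Qed.

End RealHilbert.

(** * Self-adjoint and positive operators *)

Section SelfAdjoint.
Context {R : realType} {H : hilbertType R}.
Implicit Types (S T : 'B(H)) (x y : H).

Lemma opZ T a x : T (a *: x) = a *: T x.
Proof. exact: linearZ. Qed.

Lemma opD T x y : T (x + y) = T x + T y.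
Proof. exact: linearD. Qed.

Lemma opN T x : T (- x) = - T x.
Proof. exact: linearN. Qed.

Lemma op_addE S T x : (S + T) x = S x + T x. Proof. by []. Qed.
Lemma op_oppE T x : (- T) x = - T x. Proof. by []. Qed.
Lemma op_scaleE a T x : (a *: T) x = a *: T x. Proof. by []. Qed.
Lemma op_mulE S T x : (S * T) x = S (T x). Proof. by []. Qed.
Lemma op_oneE x : (1 : 'B(H)) x = x. Proof. by []. Qed.
Lemma op_zeroE x : (0 : 'B(H)) x = 0. Proof. by []. Qed.
Definition opE := (op_addE, op_oppE, op_scaleE, op_mulE, op_oneE, op_zeroE).

(** The real part of the scalar product determines the imaginary part, since
    Im z = Re (- i z). *)
Lemma self_adjointP T :
  self_adjoint T <-> forall x y, rinner (T x) y = rinner x (T y).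
Proof.
split=> [sT x y|sT x y]; first by rewrite /rinner sT.
have Im_Re (u v : H) : complex.Im (inner u v) = rinner (- ('i%C *: u)) v.
  by rewrite /rinner linearNl linearZl_LR ReN -mulrC ReiNIm opprK.
apply/eqP; rewrite eq_complex -/(rinner _ _) -/(rinner _ _) sT eqxx /= !Im_Re.
by rewrite -sT opN opZ.
Qed.

Lemma positive_opP T : positive_op T <->
  self_adjoint T /\ forall x, 0 <= rinner (T x) x.
Proof.
split=> -[sT hT]; split=> // x.
  by have := hT x; rewrite lecE => /andP[_].
have : complex.Im (inner (T x) x) = 0.
  apply: Im_conj_eq0; rewrite [LHS]sT [LHS]hermC expr0 mul1r; exact: esym.
by rewrite lecE => ->; rewrite eqxx /= hT.
Qed.

Lemma op_bounded T : exists2 M : R, 0 < M & forall x, rnorm (T x) <= M * rnorm x.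
Proof.
have /linear_bounded_continuous/linear_boundedP := @op_continuous _ _ T.
move=> /pinfty_ex_gt0[M M0 hM].
have ME : M = (complex.Re M)%:C by rewrite RRe_real // gtr0_real.
exists (complex.Re M); first by rewrite -ltcR -ME.
by move=> x; rewrite -lecR rmorphM /= -ME -!rnormE; exact: hM.
Qed.

Lemma self_adjoint1 : self_adjoint (1 : 'B(H)). Proof. by []. Qed.

Lemma self_adjointD S T : self_adjoint S -> self_adjoint T -> self_adjoint (S + T).
Proof.
move=> /self_adjointP sS /self_adjointP sT; apply/self_adjointP => x y.
by rewrite !opE !rinnerE sS sT.
Qed.

Lemma self_adjointZ (r : R) T : self_adjoint T -> self_adjoint (r%:C *: T).
Proof.
move=> /self_adjointP sT; apply/self_adjointP => x y.
by rewrite !opE !rinnerE sT.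
Qed.

Lemma self_adjointN T : self_adjoint T -> self_adjoint (- T).
Proof.
move=> /self_adjointP sT; apply/self_adjointP => x y.
by rewrite !opE !rinnerE sT.
Qed.

Lemma self_adjointM S T : self_adjoint S -> self_adjoint T -> S * T = T * S ->
  self_adjoint (S * T).
Proof.
by move=> sS sT ST x y; rewrite {2}ST !opE sS sT.
Qed.

Lemma self_adjoint_conj S T : self_adjoint S -> self_adjoint T ->
  self_adjoint (S * T * S).
Proof. by move=> sS sT x y; rewrite !opE sS sT sS. Qed.

Lemma self_adjoint_sum n (F : 'I_n -> 'B(H)) :
  (forall i, self_adjoint (F i)) -> self_adjoint (\sum_i F i).
Proof.
move=> sF; apply: big_ind => // [|S T]; last exact: self_adjointD.
by apply/self_adjointP => x y; rewrite !opE rinner0l rinner0r.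
Qed.

Lemma self_adjointX T n : self_adjoint T -> self_adjoint (T ^+ n).
Proof.
move=> sT; elim: n => [|n IH]; first exact: self_adjoint1.
by rewrite exprS; apply: self_adjointM => //; rewrite -exprS -exprSr.
Qed.

Lemma self_adjoint_horner (p : {poly R}) T : self_adjoint T -> self_adjoint (horner_op p T).
Proof.
by move=> sT; apply: self_adjoint_sum => i; apply: self_adjointZ; exact: self_adjointX.
Qed.

(** Expand the quadratic form of T at the vector x - M^-1 T x. *)
Lemma positive_norm_le T (M : R) x : positive_op T -> 0 < M ->
  (forall y, rnorm (T y) <= M * rnorm y) ->
  rnorm (T x) ^+ 2 <= M * rinner (T x) x.
Proof.
move=> /positive_opP[/self_adjointP sT pT] M0 hM.
have := pT (x - (M^-1)%:C *: T x).
rewrite opD opN opZ !rinnerE [rinner (T (T x)) x]sT -rnorm_sqr.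
have : rinner (T (T x)) (T x) <= M * rnorm (T x) ^+ 2.
  apply: le_trans (rinner_le _ _) _; rewrite expr2 mulrA.
  by rewrite ler_wpM2r ?rnorm_ge0.
have i0 : 0 < M^-1 by rewrite invr_gt0.
rewrite -ler_pdivrMl// -(ler_pM2l i0) -(ler_pdivrMl _ _ M0) => h1 h2.
by lra.
Qed.

Lemma positive_zero T : positive_op T -> (forall x, rinner (T x) x = 0) -> T = 0.
Proof.
move=> pT T0; apply: bounded_op_ext => x /=; apply/eqP.
have [M M0 hM] := op_bounded T.
have := positive_norm_le x pT M0 hM.
by rewrite T0 mulr0 -rnorm_eq0 -sqrf_eq0 eq_le sqr_ge0 => ->.
Qed.

End SelfAdjoint.

(** * Limits and inverses of operators *)

Section Limits.
Local Open Scope classical_set_scope.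
Context {R : realType} {H : hilbertType R}.
Implicit Types (S T : 'B(H)) (x y : H).

Lemma linear_op_continuous (f : H -> H) (M : R) : linear f ->
  (forall x, rnorm (f x) <= M * rnorm x) -> continuous f.
Proof.
move=> lf fM.
pose g : {linear H -> H} := HB.pack f (GRing.isLinear.Build _ _ _ _ f lf).
apply: (bounded_linear_continuous (f := g)); apply/linear_boundedP.
near=> r => x; rewrite !rnormE; apply: (@le_trans _ _ ((`|M| * rnorm x)%:C)).
  by rewrite lecR (le_trans (fM x))// ler_wpM2r ?rnorm_ge0 ?ler_norm.
rewrite rmorphM ler_wpM2r ?ler0c ?rnorm_ge0//; near: r.
by apply: nbhs_pinfty_ge; rewrite ger0_real// ler0c.
Unshelve. all: by end_near. Qed.

Definition op_cvg (T_ : nat -> 'B(H)) S := forall e : R, 0 < e ->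
  \forall n \near \oo, forall x, rnorm (T_ n x - S x) <= e * rnorm x.

(** The limit is taken pointwise; the Cauchy bound, being relative to the norm
    of x, passes to the limit and makes it bounded. *)
Lemma op_complete (T_ : nat -> 'B(H)) :
  (forall e : R, 0 < e -> exists N, forall m n, (N <= m)%N -> (N <= n)%N ->
     forall x, rnorm (T_ m x - T_ n x) <= e * rnorm x) ->
  exists S, op_cvg T_ S.
Proof.
move=> TC.
have Tcvg x : cvg (T_ n x @[n --> \oo]).
  apply/cauchy_cvgP/cauchy_exP => e e0.
  have eE : e = (complex.Re e)%:C by rewrite RRe_real // gtr0_real.
  have r0 : 0 < complex.Re e by rewrite -ltcR -eE.
  have d0 : 0 < rnorm x + 1 by rewrite ltr_wpDl ?rnorm_ge0.
  have [N NP] := TC (complex.Re e / (rnorm x + 1)) (divr_gt0 r0 d0).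
  exists (T_ N x); exists N => // n /= Nn.
  rewrite -ball_normE /ball_ /= rnormE eE ltcR.
  apply: le_lt_trans (NP _ _ (leqnn N) Nn x) _.
  by rewrite mulrAC ltr_pdivrMr // ltr_pM2l // ltrDl.
pose l x : H := lim (T_ n x @[n --> \oo]).
have ll : linear l.
  move=> a x y; apply: cvg_lim => //.
  under eq_fun do rewrite opD opZ.
  by apply: cvgD; [apply: cvgZr; exact: Tcvg | exact: Tcvg].
have lclose e N : (forall m n, (N <= m)%N -> (N <= n)%N ->
     forall x, rnorm (T_ m x - T_ n x) <= e * rnorm x) ->
    forall n, (N <= n)%N -> forall x, rnorm (T_ n x - l x) <= e * rnorm x.
  move=> NP n Nn x; apply/ler_addgt0Pr => d d0.
  have /cvgrPdist_le/(_ d%:C) := Tcvg x; rewrite ltcR => /(_ d0) [N' _ N'P].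
  have := N'P (maxn N N') (leq_maxr _ _); rewrite /= rnormE lecR -/(l x) => h.
  rewrite rdistC in h.
  have := NP n (maxn N N') Nn (leq_maxl _ _) x.
  have := rnormD (T_ n x - T_ (maxn N N') x) (T_ (maxn N N') x - l x).
  by rewrite subrKA; lra.
have lc : continuous l.
  have [N NP] := TC 1 ltr01.
  have [M M0 MP] := op_bounded (T_ N).
  apply: (linear_op_continuous (M := M + 1)) => // x.
  have := lclose _ _ NP N (leqnn N) x; have := MP x.
  have := rnormD (T_ N x) (- (T_ N x - l x)); rewrite rnormN opprB subrKC; lra.
exists (BoundedOp ll lc) => e e0.
have [N NP] := TC e e0; exists N => // n Nn; exact: (lclose e N).
Qed.

End Limits.

Section Invertibility.
Context {R : realType} {H : hilbertType R}.
Implicit Types (S T P K : 'B(H)) (x y : H).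

Lemma positive_def_injective P (d : R) x : 0 < d ->
  (forall y, d * rnorm y ^+ 2 <= rinner (P y) y) -> P x = 0 -> x = 0.
Proof.
move=> d0 /(_ x) + Px0; rewrite Px0 rinner0l.
rewrite pmulr_rle0// => h; apply/eqP; rewrite -rnorm_eq0 -sqrf_eq0.
by rewrite eq_le h sqr_ge0.
Qed.

(** Up to the factor s, the operator S is the Neumann series of (1 - K)^-1.
    Its partial sums T_n satisfy T_(n+j) - T_n = K^n T_j, which gives the
    Cauchy property without summing norms. *)
Lemma contraction_resolvent K (r s : R) : 0 <= r < 1 ->
  (forall x, rnorm (K x) <= r * rnorm x) ->
  exists S : 'B(H), S = s%:C *: (1 : 'B(H)) + K * S.
Proof.
move=> /andP[r0 r1] hK.
pose T_ := fix T_ n : 'B(H) :=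
  if n is m.+1 then s%:C *: (1 : 'B(H)) + K * T_ m else 0.
pose C := `|s| / (1 - r).
have C0 : 0 <= C by rewrite divr_ge0// subr_ge0 ltW.
have TC j x : rnorm (T_ j x) <= C * rnorm x.
  elim: j => [|j IH]; rewrite [T_ _]/=.
    by rewrite opE rnorm0 mulr_ge0 ?rnorm_ge0.
  rewrite !opE; apply: le_trans (rnormD _ _) _; rewrite rnormZ.
  have := hK (T_ j x); have := ler_wpM2l r0 IH.
  have : C * rnorm x = `|s| * rnorm x + r * (C * rnorm x).
    by rewrite /C; field; rewrite subr_eq0 gt_eqF.
  lra.
have Tshift n j x : rnorm (T_ (n + j)%N x - T_ n x) <= r ^+ n * (C * rnorm x).
  elim: n => [|n IH]; first by rewrite add0n [T_ 0%N]/= !opE subr0 mul1r TC.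
  rewrite addSn [T_ _.+1]/= [T_ n.+1]/= !opE opprD addrACA subrr add0r.
  rewrite -opN -opD.
  by apply: le_trans (hK _) _; rewrite exprS -mulrA ler_wpM2l.
have [S TS] : exists S, op_cvg T_ S.
  apply: op_complete => e e0.
  have e1 : 0 < e / (2 * (C + 1)) by rewrite divr_gt0// mulr_gt0// ltr_wpDl.
  have rn : `|r| < 1 by rewrite ger0_norm.
  have /cvgrPdist_le/(_ _ e1)[N _ NP] := cvg_expr rn.
  have close m : (N <= m)%N -> forall x, rnorm (T_ m x - T_ N x) <= e / 2 * rnorm x.
    move=> Nm x; rewrite -(subnKC Nm); apply: le_trans (Tshift _ _ _) _.
    rewrite mulrA ler_wpM2r ?rnorm_ge0//.
    have := NP N (leqnn N); rewrite /= sub0r normrN ger0_norm ?exprn_ge0// => h.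
    apply: le_trans (ler_wpM2r C0 h) _.
    have -> : e / 2 = e / (2 * (C + 1)) * (C + 1) by field; rewrite gt_eqF// ltr_wpDl.
    by rewrite ler_wpM2l ?(ltW e1)// lerDl.
  exists N => m n Nm Nn x; have := close m Nm x; have := close n Nn x.
  have := rnormD (T_ m x - T_ N x) (T_ N x - T_ n x).
  by rewrite subrKA [rnorm (T_ N x - _)]rdistC; lra.
exists S; apply: bounded_op_ext => x; apply/eqP.
rewrite -subr_eq0 -rnorm_eq0 eq_le rnorm_ge0 andbT; apply/ler_addgt0Pr => d d0.
have d1 : 0 < rnorm x + 1 by rewrite ltr_wpDl ?rnorm_ge0.
have d2 : 0 < d / 2 by rewrite divr_gt0.
have [N _ NP] := TS _ (divr_gt0 d2 d1).
have small : d / 2 / (rnorm x + 1) * rnorm x <= d / 2.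
  by rewrite mulrAC ler_pdivrMr// ler_wpM2l ?ltW// ltrDl.
have h0 := le_trans (NP N (leqnn N) x) small.
have h1 := le_trans (NP N.+1 (leqnSn N) x) small.
have h2 : rnorm (T_ N.+1 x - (s%:C *: (1 : 'B(H)) + K * S) x) <= d / 2.
  rewrite [T_ _]/= !opE opprD addrACA subrr add0r -opN -opD.
  apply: le_trans (hK _) _; apply: le_trans h0.
  by rewrite ler_piMl ?rnorm_ge0 ?ltW.
have := rnormD (S x - T_ N.+1 x) (T_ N.+1 x - (s%:C *: (1 : 'B(H)) + K * S) x).
rewrite subrKA [rnorm (S x - _)]rdistC; lra.
Qed.

(** For small s > 0 the operator K = 1 - s P is a contraction: the square of
    the norm of K x is at most that of x minus s times the quadratic form of
    P.  A solution of S = s 1 + K S is a right inverse of P, and it is a left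
    inverse because P is injective. *)
Lemma positive_def_invertible P (d : R) : self_adjoint P -> 0 < d ->
  (forall x, d * rnorm x ^+ 2 <= rinner (P x) x) -> invertible_op P.
Proof.
move=> sP d0 dP.
have [M M0 MP] := op_bounded P.
(* Adding d to the bound M ensures s d <= 1. *)
pose L := M + d; have L0 : 0 < L by rewrite addr_gt0.
pose s := L^-1; have s0 : 0 < s by rewrite invr_gt0.
have sL : s * L = 1 by rewrite mulVf// gt_eqF.
have pP : positive_op P.
  apply/positive_opP; split=> // x; apply: le_trans (dP x).
  by rewrite mulr_ge0 ?sqr_ge0 ?ltW.
have sd1 : s * d <= 1.
  by rewrite mulrC ler_pdivrMr// mul1r /L lerDr ltW.
(* r is nonnegative and r ^+ 2 >= 1 - s d, with no square root involved. *)
pose r := 1 - s * d / 2.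
have sd0 : 0 < s * d by rewrite mulr_gt0.
have hK x : rnorm ((1 - s%:C *: P) x) <= r * rnorm x.
  rewrite -(@ler_pXn2r _ 2)// ?nnegrE ?rnorm_ge0 ?mulr_ge0 ?rnorm_ge0//;
    last by rewrite /r; lra.
  have LP y : rnorm (P y) <= L * rnorm y.
    by apply: le_trans (MP y) _; rewrite ler_wpM2r ?rnorm_ge0// /L lerDl ltW.
  have h1 : s * (s * rnorm (P x) ^+ 2) <= s * rinner (P x) x.
    by rewrite ler_pM2l// ler_pdivrMl//; apply: positive_norm_le.
  have h2 : s * d * rnorm x ^+ 2 <= s * rinner (P x) x by rewrite -mulrA ler_pM2l.
  rewrite rnorm_sqr !opE !rinnerE (rinnerC x) -!rnorm_sqr.
  move: h1 h2; rewrite exprMn /r; have := sqr_ge0 (rnorm x).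
  move: (s * d) sd0 sd1 (rnorm x ^+ 2) => u u0 u1 w w0.
  have : 0 <= u ^+ 2 * w by rewrite mulr_ge0 ?sqr_ge0.
  move: (s * rinner _ _) => q; lra.
have r01 : 0 <= r < 1 by rewrite /r; lra.
have [S SE] := contraction_resolvent s r01 hK.
have PS : P * S = 1.
  apply: bounded_op_ext => x; have := congr1 (fun T : 'B(H) => T x) SE.
  rewrite !opE => /eqP; rewrite addrCA -[X in X == _]addr0 (inj_eq (addrI _)).
  rewrite eq_sym subr_eq0 => /eqP /(congr1 (fun y => (L%:C) *: y)).
  by rewrite !scalerA -rmorphM /= divff ?gt_eqF// !scale1r.
exists S; split=> //; apply: bounded_op_ext => x; apply/eqP; rewrite -subr_eq0.
apply/eqP/(positive_def_injective d0 dP); rewrite opD opN.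
by rewrite -op_mulE mulrA PS mul1r subrr.
Qed.

End Invertibility.

(** * Polynomials of an operator *)

Section OpPoly.
Context {R : realType} {H : hilbertType R}.
Implicit Types (S T P : 'B(H)) (q : {poly R[i]}) (p : {poly R}).

Lemma op_scaleAl (a : R[i]) S T : (a *: S) * T = a *: (S * T).
Proof. exact: bounded_op_ext. Qed.

Lemma op_scaleAr (a : R[i]) S T : S * (a *: T) = a *: (S * T).
Proof. by apply: bounded_op_ext => x; rewrite !opE opZ. Qed.

(** Complex coefficients are needed to split a real polynomial into linear
    factors. *)
Definition cpoly_op q T : 'B(H) := \sum_(i < size q) q`_i *: T ^+ i.

Lemma cpoly_op_widen q T n : (size q <= n)%N ->
  cpoly_op q T = \sum_(i < n) q`_i *: T ^+ i.
Proof.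
move=> qn; rewrite /cpoly_op (big_ord_widen n (fun i => q`_i *: T ^+ i) qn).
rewrite big_mkcond; apply: eq_bigr => i _; case: ltnP => // qi.
by rewrite nth_default// scale0r.
Qed.

Lemma cpoly_opD q1 q2 T : cpoly_op (q1 + q2) T = cpoly_op q1 T + cpoly_op q2 T.
Proof.
rewrite (cpoly_op_widen T (size_polyD q1 q2)).
rewrite (cpoly_op_widen T (leq_maxl (size q1) (size q2))).
rewrite (cpoly_op_widen T (leq_maxr (size q1) (size q2))) -big_split /=.
by apply: eq_bigr => i _; rewrite coefD scalerDl.
Qed.

Lemma cpoly_opZ a q T : cpoly_op (a *: q) T = a *: cpoly_op q T.
Proof.
rewrite (cpoly_op_widen T (size_scale_leq a q)) scaler_sumr.
by apply: eq_bigr => i _; rewrite coefZ scalerA.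
Qed.

Lemma cpoly_op0 T : cpoly_op 0 T = 0.
Proof. by rewrite /cpoly_op size_poly0 big_ord0. Qed.

Lemma cpoly_opC a T : cpoly_op a%:P T = a *: (1 : 'B(H)).
Proof. by rewrite (cpoly_op_widen T (size_polyC_leq1 a)) big_ord1 coefC expr0. Qed.

Lemma cpoly_opX T : cpoly_op 'X T = T.
Proof.
rewrite /cpoly_op size_polyX !big_ord_recl big_ord0 !coefX /=.
by rewrite scale0r scale1r add0r addr0 expr1.
Qed.

Lemma cpoly_op_mulX q T : cpoly_op (q * 'X) T = cpoly_op q T * T.
Proof.
have sz : (size (q * 'X)%R <= (size q).+1)%N.
  by apply: leq_trans (size_polyMleq _ _) _; rewrite size_polyX addn2.
rewrite (cpoly_op_widen T sz) big_ord_recl coefMX eqxx scale0r add0r.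
rewrite /cpoly_op mulr_suml; apply: eq_bigr => i _.
by rewrite coefMX /= op_scaleAl -exprSr.
Qed.

Lemma cpoly_opM q1 q2 T : cpoly_op (q1 * q2) T = cpoly_op q1 T * cpoly_op q2 T.
Proof.
elim/poly_ind: q2 => [|q2 a IH]; first by rewrite mulr0 !cpoly_op0 mulr0.
rewrite mulrDr cpoly_opD mulrA cpoly_op_mulX IH cpoly_opD cpoly_op_mulX cpoly_opC.
by rewrite mulrDr mulrA op_scaleAr mulr1 mulrC mul_polyC cpoly_opZ.
Qed.

Lemma horner_opE p T : horner_op p T = cpoly_op (map_poly (real_complex R) p) T.
Proof.
rewrite /cpoly_op size_map_poly; apply: eq_bigr => i _.
by rewrite coef_map.
Qed.

Lemma horner_opD p1 p2 T : horner_op (p1 + p2) T = horner_op p1 T + horner_op p2 T.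
Proof. by rewrite !horner_opE rmorphD cpoly_opD. Qed.

Lemma horner_opM p1 p2 T : horner_op (p1 * p2) T = horner_op p1 T * horner_op p2 T.
Proof. by rewrite !horner_opE rmorphM cpoly_opM. Qed.

Lemma horner_opZ (a : R) p T : horner_op (a *: p) T = a%:C *: horner_op p T.
Proof. by rewrite !horner_opE map_polyZ cpoly_opZ. Qed.

Lemma horner_opC (a : R) T : horner_op a%:P T = a%:C *: (1 : 'B(H)).
Proof. by rewrite horner_opE map_polyC cpoly_opC. Qed.

Lemma horner_opX T : horner_op 'X T = T.
Proof. by rewrite horner_opE map_polyX cpoly_opX. Qed.

Lemma invertible_opM S T : invertible_op S -> invertible_op T ->
  invertible_op (S * T).
Proof.
move=> [S' [S'S SS']] [T' [T'T TT']]; exists (T' * S'); split.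
  by rewrite mulrA -(mulrA T') S'S mulr1.
by rewrite mulrA -(mulrA S) TT' mulr1.
Qed.

Lemma invertible_opMl S T : S * T = T * S -> invertible_op (S * T) ->
  invertible_op S.
Proof.
move=> ST [U [UST STU]]; exists (T * U); split; last by rewrite mulrA.
have TUS : U * T * S = 1 by rewrite -mulrA -ST.
have <- : U * T = T * U; last exact: TUS.
by rewrite -[T * U]mul1r -{1}TUS -!mulrA (mulrA S T) STU mulr1.
Qed.

Lemma invertible_opZ (a : R[i]) T : a != 0 -> invertible_op T -> invertible_op (a *: T).
Proof.
move=> a0 [S [ST TS]]; exists (a^-1 *: S).
by rewrite !op_scaleAl !op_scaleAr !scalerA ST TS mulVf// mulfV// scale1r.
Qed.

(** A product of the invertible operators T - z, z ranging over the roots. *)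
Lemma cpoly_op_invertible q T : q != 0 ->
  (forall z, root q z -> ~ spectrum T z) -> invertible_op (cpoly_op q T).
Proof.
have [r ->] := closed_field_poly_normal q.
rewrite scaler_eq0 negb_or => /andP[c0 _] noroot.
rewrite cpoly_opZ; apply: invertible_opZ => //.
have {}noroot z : z \in r -> ~ spectrum T z.
  by move=> zr; apply: noroot; rewrite rootZ// root_prod_XsubC.
elim: r {c0} noroot => [|z r IH] noroot.
  by rewrite big_nil -(polyC1) cpoly_opC scale1r; exists 1; rewrite mulr1.
rewrite big_cons cpoly_opM; apply: invertible_opM; last first.
  by apply: IH => w wr; apply: noroot; rewrite in_cons wr orbT.
have /contrapT := noroot z (mem_head _ _).
rewrite cpoly_opD cpoly_opX -polyCN cpoly_opC scaleNr; exact.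
Qed.

End OpPoly.

(** * The spectrum of a self-adjoint operator *)

Section Spectrum.
Local Open Scope classical_set_scope.
Context {R : realType} {H : hilbertType R}.
Implicit Types (S T P : 'B(H)) (x y : H) (p : {poly R}).

(** If S is the inverse and K, M bound S and P, then the square of the norm of
    x = S P x is at most K^2 times that of P x, which [positive_norm_le]
    bounds by M times the quadratic form. *)
Lemma invertible_positive_def P : positive_op P -> invertible_op P ->
  exists2 d : R, 0 < d & forall x, d * rnorm x ^+ 2 <= rinner (P x) x.
Proof.
move=> pP [S [SP _]].
have [M M0 MP] := op_bounded P; have [K K0 KS] := op_bounded S.
exists (K ^+ 2 * M)^-1; first by rewrite invr_gt0 mulr_gt0 ?exprn_gt0.
move=> x; rewrite ler_pdivrMl ?mulr_gt0 ?exprn_gt0// -mulrA.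
apply: (@le_trans _ _ (K ^+ 2 * rnorm (P x) ^+ 2)); last first.
  by rewrite ler_wpM2l ?sqr_ge0//; exact: positive_norm_le.
rewrite -exprMn ler_pXn2r ?nnegrE ?mulr_ge0 ?rnorm_ge0 ?(ltW K0)//.
by have := KS (P x); rewrite -op_mulE SP.
Qed.

Lemma rinner_shift T (a : R) x :
  rinner ((T - a%:C *: (1 : 'B(H))) x) x = rinner (T x) x - a * rnorm x ^+ 2.
Proof. by rewrite !opE !rinnerE rnorm_sqr. Qed.

Lemma self_adjoint_shift T (a : R) : self_adjoint T -> self_adjoint (T - a%:C *: (1 : 'B(H))).
Proof.
by move=> sT; apply: self_adjointD => //; apply/self_adjointN/self_adjointZ/self_adjoint1.
Qed.

(** If T were not positive, the infimum m of its quadratic form on the unit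
    sphere would be negative.  But m is in the spectrum: otherwise
    T - m would be bounded below by some d > 0, and m + d would be a lower
    bound of the numerical range. *)
Lemma positive_of_spectrum T : self_adjoint T ->
  (forall t : R, spectrum T t%:C -> 0 <= t) -> positive_op T.
Proof.
move=> sT specT; apply/positive_opP; split=> // x0; rewrite leNgt; apply/negP => neg.
pose E := [set r | exists2 x, rnorm x = 1 & rinner (T x) x = r].
have [M M0 MT] := op_bounded T.
have unit_vector x : x != 0 -> rnorm (((rnorm x)^-1)%:C *: x) = 1.
  move=> x0N; rewrite rnormZ ger0_norm ?invr_ge0 ?rnorm_ge0// mulVf//.
  by rewrite rnorm_eq0.
have quad x : x != 0 -> E (rinner (T x) x / rnorm x ^+ 2).
  move=> x0N; exists (((rnorm x)^-1)%:C *: x); first exact: unit_vector.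
  by rewrite opZ !rinnerE; field; rewrite rnorm_eq0.
have x0N : x0 != 0 by apply: contraTneq neg => ->; rewrite rinner0r ltxx.
have infE : has_inf E.
  split; first by exists (rinner (T x0) x0 / rnorm x0 ^+ 2); exact: quad.
  exists (- M) => _ [x x1 <-]; rewrite lerNl -rinnerNl.
  apply: le_trans (rinner_le _ _) _; rewrite rnormN x1 mulr1.
  by have := MT x; rewrite x1 mulr1.
pose m := inf E.
have mE x : m * rnorm x ^+ 2 <= rinner (T x) x.
  have [->|xN] := eqVneq x 0; first by rewrite rinner0r rnorm0 expr0n mulr0.
  rewrite -ler_pdivlMr ?exprn_gt0 ?lt_def ?rnorm_eq0 ?xN ?rnorm_ge0//.
  by apply: ge_inf; [case: infE | exact: quad].
have : spectrum T m%:C.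
  move=> inv.
  have [|d d0 dP] := invertible_positive_def _ inv.
    apply/positive_opP; split; first exact: self_adjoint_shift.
    by move=> x; rewrite rinner_shift subr_ge0.
  have : m + d <= m; last by rewrite gerDl leNgt d0.
  apply: lb_le_inf; first by case: infE.
  move=> _ [x x1 <-]; have := dP x; rewrite rinner_shift x1 expr1n !mulr1; lra.
move=> /specT; apply/negP; rewrite -ltNge.
have s0 : 0 < rnorm x0 ^+ 2 by rewrite exprn_gt0// lt_def rnorm_eq0 x0N rnorm_ge0.
rewrite -(pmulr_llt0 _ s0); exact: le_lt_trans (mE x0) neg.
Qed.

(** For t outside [a, b] either T - t or t - T is bounded below by a positive
    constant. *)
Lemma spectrum_bounds T (a b t : R) : self_adjoint T ->
  (forall x, a * rnorm x ^+ 2 <= rinner (T x) x <= b * rnorm x ^+ 2) ->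
  spectrum T t%:C -> a <= t <= b.
Proof.
move=> sT ab st; apply/andP; split; rewrite leNgt; apply/negP => ht; apply: st.
  apply: (@positive_def_invertible _ _ _ (a - t)); rewrite ?subr_gt0//.
    exact: self_adjoint_shift.
  by move=> x; rewrite rinner_shift; have /andP[] := ab x; lra.
rewrite -opprB -scaleN1r; apply: invertible_opZ; first by rewrite oppr_eq0 oner_eq0.
apply: (@positive_def_invertible _ _ _ (t - b)); rewrite ?subr_gt0//.
  by rewrite -opprB; apply/self_adjointN/self_adjoint_shift.
by move=> x; rewrite -opprB op_oppE rinnerNl rinner_shift; have /andP[] := ab x; lra.
Qed.

Lemma op_mulBD T (c : R[i]) :
  (T - c *: (1 : 'B(H))) * (T + c *: (1 : 'B(H))) = T * T - (c * c) *: (1 : 'B(H)).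
Proof.
rewrite mulrDr !mulrBl !op_scaleAr !op_scaleAl !mulr1 !mul1r scalerA.
by rewrite addrA subrK.
Qed.

Lemma op_mulDB T (c : R[i]) :
  (T + c *: (1 : 'B(H))) * (T - c *: (1 : 'B(H))) = T * T - (c * c) *: (1 : 'B(H)).
Proof. by have := op_mulBD T (- c); rewrite mulrNN scaleNr opprK. Qed.

(** For a nonzero b, (U - i b)(U + i b) = U^2 + b^2 is bounded below by b^2,
    hence invertible, and so is each of the two commuting factors. *)
Lemma spectrum_real T (z : R[i]) : self_adjoint T -> spectrum T z ->
  z = (complex.Re z)%:C.
Proof.
case: z => a b sT /= sz; apply/eqP; rewrite eq_complex /= eqxx /=.
apply/negP => /negP b0; apply: sz.
have -> : a +i* b = a%:C + 'i%C * b%:C by rewrite [LHS]complexE.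
pose U := T - a%:C *: (1 : 'B(H)).
have sU : self_adjoint U by exact: self_adjoint_shift.
pose V := U + ('i%C * b%:C) *: (1 : 'B(H)).
have -> : T - (a%:C + 'i%C * b%:C) *: (1 : 'B(H)) = U - ('i%C * b%:C) *: (1 : 'B(H)).
  by rewrite scalerDl opprD addrA.
set W := _ - _.
have cc : 'i%C * b%:C * ('i%C * b%:C) = - (b ^+ 2)%:C :> R[i].
  by rewrite mulrACA -!expr2 sqr_i mulN1r rmorphXn.
have WV : W * V = U * U + (b ^+ 2)%:C *: (1 : 'B(H)).
  by rewrite /W /V op_mulBD cc scaleNr opprK.
have VW : V * W = U * U + (b ^+ 2)%:C *: (1 : 'B(H)).
  by rewrite /W /V op_mulDB cc scaleNr opprK.
apply: (@invertible_opMl _ _ _ V); first by rewrite WV VW.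
rewrite WV; apply: (@positive_def_invertible _ _ _ (b ^+ 2)).
- apply: self_adjointD; first by apply: self_adjointM.
  exact/self_adjointZ/self_adjoint1.
- by rewrite lt_def sqrf_eq0 b0 sqr_ge0.
- move=> x; rewrite op_addE op_mulE op_scaleE op_oneE rinnerDl rinnerZl -rnorm_sqr.
  by have /self_adjointP-> := sU; rewrite -rnorm_sqr lerDr sqr_ge0.
Qed.

(** With an empty spectrum every shift T - c is positive, which is absurd on a
    nonzero vector once c exceeds its Rayleigh quotient. *)
Lemma spectrum_empty_trivial T : self_adjoint T ->
  (forall t : R, ~ spectrum T t%:C) -> forall x : H, x = 0.
Proof.
move=> sT sp0 x; apply/eqP/negPn/negP => xN.
pose c := rinner (T x) x / rnorm x ^+ 2 + 1.
have s0 : 0 < rnorm x ^+ 2 by rewrite exprn_gt0// lt_def rnorm_eq0 xN rnorm_ge0.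
have /positive_opP[_ /(_ x)] : positive_op (T - c%:C *: (1 : 'B(H))).
  apply: positive_of_spectrum; first exact: self_adjoint_shift.
  move=> t; rewrite /spectrum /= -addrA -opprD -scalerDl -rmorphD => st.
  by case: (sp0 _ st).
rewrite rinner_shift /c mulrDl divfK ?gt_eqF// mul1r; lra.
Qed.

(** A negative number mu of the spectrum of p(T) would give p(T) - mu not
    invertible, although p - mu is positive on the spectrum of T, so has no
    root there. *)
Lemma horner_op_positive p T : self_adjoint T ->
  (forall t : R, spectrum T t%:C -> 0 <= p.[t]) -> positive_op (horner_op p T).
Proof.
move=> sT pT.
have sp := self_adjoint_horner p sT.
apply: positive_of_spectrum => // mu smu; rewrite leNgt; apply/negP => mu0.
apply: smu; rewrite horner_opE -(cpoly_opC _ T) -scaleN1r -cpoly_opZ -cpoly_opD.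
set q := _ + _.
have qE (t : R) : q.[t%:C] = (p.[t] - mu)%:C.
  by rewrite !hornerE horner_map mulN1r rmorphB.
have noroot z : root q z -> ~ spectrum T z.
  move=> rz sz; move: (spectrum_real sT sz) => zE.
  move: rz sz; rewrite zE rootE qE (inj_eq (@complexI R) _ 0) subr_eq0 => /eqP h sz.
  by have := pT _ sz; rewrite h leNgt mu0.
(* q = 0 makes every number a root, so the spectrum is empty and H = 0. *)
have [q0|] := eqVneq q 0; last by move=> q0; exact: cpoly_op_invertible.
exists 0; suff triv x : x = 0 :> H.
  by split; apply: bounded_op_ext => x; rewrite [LHS]triv [RHS]triv.
by apply: (spectrum_empty_trivial sT) => t; apply: noroot; rewrite q0 root0.
Qed.

(** The polynomial e^2 - p^2 is nonnegative on the spectrum, and the quadratic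
    form of p(T)^2 is the square of the norm of p(T) x. *)
Lemma horner_op_norm_le p T (e : R) x : self_adjoint T -> 0 <= e ->
  (forall t : R, spectrum T t%:C -> `|p.[t]| <= e) ->
  rnorm (horner_op p T x) <= e * rnorm x.
Proof.
move=> sT e0 pT.
have /positive_opP[_ /(_ x)] : positive_op (horner_op ((e ^+ 2)%:P + (-1) *: (p * p)) T).
  apply: horner_op_positive => // t /pT h.
  rewrite hornerD hornerC hornerZ hornerM mulN1r subr_ge0.
  by rewrite -expr2 -[leLHS]real_normK ?num_real// ler_pXn2r ?nnegrE.
rewrite horner_opD horner_opZ horner_opC horner_opM !opE !rinnerE.
have /self_adjointP-> := self_adjoint_horner p sT.
rewrite -!rnorm_sqr mulN1r subr_ge0 -exprMn ler_pXn2r ?nnegrE ?rnorm_ge0//.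
by rewrite mulr_ge0 ?rnorm_ge0.
Qed.

End Spectrum.

(** * Continuous functional calculus *)

Section Calculus.
Local Open Scope classical_set_scope.
Context {R : realType} {H : hilbertType R}.
Implicit Types (S T : 'B(H)) (x y : H) (f g : R -> R).

Definition spec_approx f T (p : nat -> {poly R}) := forall e : R, 0 < e ->
  \forall n \near \oo, forall t : R, spectrum T t%:C -> `|(p n).[t] - f t| <= e.

(** Separating the approximation of f from the convergence of operators lets
    each operation be treated in two independent halves. *)
Lemma is_cfcP f T S : is_cfc f T S <->
  exists p, spec_approx f T p /\ op_cvg (fun n => horner_op (p n) T) S.
Proof.
split=> [[p pP]|[p [pf pS]]]; exists p.
  split=> e /pP[N _ NP]; exists N => // n /NP[h1 h2] // x.
  by have := h2 x; rewrite !rnormE -rmorphM lecR.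
move=> e e0; have [N _ NP] := pf e e0; have [N' _ NP'] := pS e e0.
exists (maxn N N') => // n /=; rewrite geq_max => /andP[h1 h2].
by split=> [|x]; [exact: NP | rewrite !rnormE -rmorphM lecR; exact: NP'].
Qed.

(** Error estimates need to be right only up to a constant factor, and only
    for small errors. *)
Lemma op_cvg_scaled (T_ : nat -> 'B(H)) S (C : R) : 0 <= C ->
  (forall e : R, 0 < e < 1 -> \forall n \near \oo, forall x,
     rnorm (T_ n x - S x) <= C * e * rnorm x) -> op_cvg T_ S.
Proof.
move=> C0 h e e0.
pose d := Num.min (e / (C + 1)) (1 / 2).
have C1 : 0 < C + 1 by rewrite ltr_wpDl.
have d0 : 0 < d < 1.
  rewrite lt_min divr_gt0//= divr_gt0//= /d gt_min.
  by rewrite [X in _ || X](_ : _ = true) ?orbT//; lra.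
have [N _ NP] := h d d0; exists N => // n Nn x; apply: le_trans (NP n Nn x) _.
rewrite ler_wpM2r ?rnorm_ge0//.
have dE : d <= e / (C + 1) by rewrite ge_min lexx.
apply: le_trans (ler_wpM2l C0 dE) _.
by rewrite mulrC mulrAC ler_pdivrMr// ler_wpM2l ?(ltW e0)// lerDl.
Qed.

Lemma op_cvgD (S_ T_ : nat -> 'B(H)) S T :
  op_cvg S_ S -> op_cvg T_ T -> op_cvg (fun n => S_ n + T_ n) (S + T).
Proof.
move=> hS hT; apply: (@op_cvg_scaled _ _ 2) => // e /andP[e0 _].
near=> n => x; rewrite !opE opprD addrACA; apply: le_trans (rnormD _ _) _.
rewrite [2 * e * _](_ : _ = e * rnorm x + e * rnorm x); last by ring.
by apply: lerD; move: x; near: n; [exact: hS|exact: hT].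
Unshelve. all: by end_near. Qed.

Lemma op_cvgZ (a : R) (S_ : nat -> 'B(H)) S :
  op_cvg S_ S -> op_cvg (fun n => a%:C *: S_ n) (a%:C *: S).
Proof.
move=> hS; apply: (@op_cvg_scaled _ _ `|a|) => // e /andP[e0 _].
near=> n => x; rewrite !opE -scalerBr rnormZ -mulrA ler_wpM2l//.
by move: x; near: n; exact: hS.
Unshelve. all: by end_near. Qed.

Lemma op_cvgM (S_ T_ : nat -> 'B(H)) S T :
  op_cvg S_ S -> op_cvg T_ T -> op_cvg (fun n => S_ n * T_ n) (S * T).
Proof.
move=> hS hT.
have [M M0 MS] := op_bounded S; have [K K0 KT] := op_bounded T.
apply: (@op_cvg_scaled _ _ (M + 1 + K)) => [|e /andP[e0 e1]].
  by rewrite !addr_ge0// ltW.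
near=> n => x; rewrite !opE.
have hSn y : rnorm (S_ n y - S y) <= e * rnorm y by move: y; near: n; exact: hS.
have hTn : rnorm (T_ n x - T x) <= e * rnorm x by move: x; near: n; exact: hT.
have h1 : rnorm (S_ n (T_ n x - T x)) <= (M + 1) * (e * rnorm x).
  have : rnorm (S_ n (T_ n x - T x)) <= (M + 1) * rnorm (T_ n x - T x).
    have := hSn (T_ n x - T x); have := MS (T_ n x - T x).
    have := rnormD (S_ n (T_ n x - T x) - S (T_ n x - T x)) (S (T_ n x - T x)).
    rewrite subrK; have := rnorm_ge0 (T_ n x - T x).
    move: (rnorm _) (rnorm (S _)) (rnorm (_ - _)) (rnorm _) => u w z r; nra.
  by move/le_trans; apply; rewrite ler_wpM2l// addr_ge0// ltW.
have h2 := hSn (T x); have h3 := KT x.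
have h4 := ler_wpM2l (ltW e0) h3.
rewrite opD opN in h1.
have := rnormD (S_ n (T_ n x) - S_ n (T x)) (S_ n (T x) - S (T x)).
rewrite subrKA; lra.
Unshelve. all: by end_near. Qed.

Lemma is_cfc_horner (p : {poly R}) T : is_cfc (horner p) T (horner_op p T).
Proof.
apply/is_cfcP; exists (fun=> p); split=> e e0; exists 0%N => // n _.
  by move=> t _; rewrite subrr normr0 ltW.
by move=> x; rewrite subrr rnorm0 mulr_ge0 ?rnorm_ge0 ?ltW.
Qed.

Lemma is_cfcD f g T S S' : is_cfc f T S -> is_cfc g T S' ->
  is_cfc (fun t => f t + g t) T (S + S').
Proof.
move=> /is_cfcP[p [pf pS]] /is_cfcP[q [qg qS]]; apply/is_cfcP.
exists (fun n => p n + q n); split; last first.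
  by under eq_fun do rewrite horner_opD; exact: op_cvgD.
move=> e e0; have e2 : 0 < e / 2 by rewrite divr_gt0.
near=> n => t st; rewrite hornerD opprD addrACA; apply: le_trans (ler_normD _ _) _.
have -> : e = e / 2 + e / 2 by field.
by apply: lerD; move: t st; near: n; [exact: pf|exact: qg].
Unshelve. all: by end_near. Qed.

Lemma is_cfcZ (a : R) f T S : is_cfc f T S -> is_cfc (fun t => a * f t) T (a%:C *: S).
Proof.
move=> /is_cfcP[p [pf pS]]; apply/is_cfcP.
exists (fun n => a *: p n); split; last first.
  by under eq_fun do rewrite horner_opZ; exact: op_cvgZ.
move=> e e0; have a1 : 0 < `|a| + 1 by rewrite ltr_wpDl.
near=> n => t st; rewrite hornerZ -mulrBr normrM.
have h : `|(p n).[t] - f t| <= e / (`|a| + 1).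
  by move: t st; near: n; apply: pf; rewrite divr_gt0.
apply: le_trans (ler_wpM2l (normr_ge0 a) h) _.
by rewrite mulrC mulrAC ler_pdivrMr// ler_wpM2l ?(ltW e0)// lerDl.
Unshelve. all: by end_near. Qed.

(** The bound B is what makes a product of uniformly convergent sequences
    converge uniformly. *)
Lemma is_cfcM f g T S S' (B : R) :
  (forall t : R, spectrum T t%:C -> `|f t| <= B /\ `|g t| <= B) ->
  is_cfc f T S -> is_cfc g T S' -> is_cfc (fun t => f t * g t) T (S * S').
Proof.
move=> fgB /is_cfcP[p [pf pS]] /is_cfcP[q [qg qS]]; apply/is_cfcP.
exists (fun n => p n * q n); split; last first.
  by under eq_fun do rewrite horner_opM; exact: op_cvgM.
move=> e e0; pose B1 := 2 * `|B| + 1.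
have B10 : 0 < B1 by rewrite /B1; have := normr_ge0 B; lra.
pose d := Num.min (e / B1) 1.
have d0 : 0 < d by rewrite lt_min divr_gt0//=.
near=> n => t st; rewrite hornerM.
have h1 : `|(p n).[t] - f t| <= d by move: t st; near: n; exact: pf.
have h2 : `|(q n).[t] - g t| <= d by move: t st {h1}; near: n; exact: qg.
have [fB gB] := fgB t st.
have dE : d * B1 <= e by rewrite -ler_pdivlMr// ge_min lexx.
have d1 : d <= 1 by rewrite ge_min lexx orbT.
have -> : (p n).[t] * (q n).[t] - f t * g t =
  ((p n).[t] - f t) * ((q n).[t] - g t) + ((p n).[t] - f t) * g t + f t * ((q n).[t] - g t).
  by ring.
apply: le_trans dE.
apply: le_trans (ler_normD _ _) _; rewrite (normrM (f t)).
apply: le_trans (lerD (ler_normD _ _) (lexx _)) _; rewrite !normrM.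
have k1 : `|(p n).[t] - f t| * `|(q n).[t] - g t| <= d * 1.
  by apply: ler_pM => //; apply: le_trans d1.
have k2 : `|(p n).[t] - f t| * `|g t| <= d * `|B|.
  by apply: ler_pM => //; apply: le_trans gB (ler_norm _).
have k3 : `|f t| * `|(q n).[t] - g t| <= `|B| * d.
  by apply: ler_pM => //; apply: le_trans fB (ler_norm _).
rewrite /B1; lra.
Unshelve. all: by end_near. Qed.

Lemma is_cfc_eq f g T S : (forall t : R, spectrum T t%:C -> f t = g t) ->
  is_cfc f T S -> is_cfc g T S.
Proof.
move=> fg /is_cfcP[p [pf pS]]; apply/is_cfcP; exists p; split=> // e e0.
by near=> n => t st; rewrite -fg//; move: t st; near: n; exact: pf.
Unshelve. all: by end_near. Qed.

(** If p_n >= - e on the spectrum, then p_n(T) + e is positive, and positivity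
    passes to the limit as e tends to 0; so does self-adjointness. *)
Lemma is_cfc_ge0 f T S : self_adjoint T ->
  (forall t : R, spectrum T t%:C -> 0 <= f t) -> is_cfc f T S -> positive_op S.
Proof.
move=> sT f0 /is_cfcP[p [pf pS]].
have close (e : R) x y : 0 < e -> \forall n \near \oo,
    `|rinner (horner_op (p n) T x) y - rinner (S x) y| <= e * (rnorm x * rnorm y).
  move=> e0; near=> n.
  have h : rnorm (horner_op (p n) T x - S x) <= e * rnorm x.
    by move: x; near: n; exact: pS.
  rewrite -rinnerNl -rinnerDl mulrA ler_norml lerNl -rinnerNl.
  rewrite !(le_trans (rinner_le _ _)) ?rnormN ?ler_wpM2r ?rnorm_ge0//.
apply/positive_opP; split.
  apply/self_adjointP => x y; apply/eqP; rewrite -subr_eq0 -normr_eq0 eq_le normr_ge0 andbT.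
  apply/ler_addgt0Pr => d d0.
  pose C := rnorm x * rnorm y; have C0 : 0 <= C by rewrite mulr_ge0 ?rnorm_ge0.
  have C1 : 0 < 2 * (C + 1) by lra.
  have e0 := divr_gt0 d0 C1.
  near \oo => n.
  have h1 : `|rinner (horner_op (p n) T x) y - rinner (S x) y| <= d / (2 * (C + 1)) * C.
    by near: n; exact: close.
  have h2 : `|rinner (horner_op (p n) T y) x - rinner (S y) x| <=
      d / (2 * (C + 1)) * (rnorm y * rnorm x).
    by near: n; exact: close.
  rewrite (mulrC (rnorm y)) -/C in h2.
  have /self_adjointP sp := self_adjoint_horner (p n) sT.
  have h3 : d / (2 * (C + 1)) * C <= d / 2.
    rewrite mulrAC ler_pdivrMr// -subr_ge0.
    by rewrite [X in 0 <= X](_ : _ = d) ?ltW//; field.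
  move: h1 h2; rewrite (rinnerC (S y)) (rinnerC (horner_op _ _ y)) -sp !ler_norml.
  move=> /andP[? ?] /andP[? ?]; lra.
move=> x; apply/ler_addgt0Pr => d d0.
pose C := rnorm x * rnorm x; have C0 : 0 <= C by rewrite mulr_ge0 ?rnorm_ge0.
have C1 : 0 < 2 * (C + 1) by lra.
have e0 := divr_gt0 d0 C1; set e := d / _ in e0.
near \oo => n.
have h1 : `|rinner (horner_op (p n) T x) x - rinner (S x) x| <= e * C.
  by near: n; exact: close.
have /positive_opP[_ /(_ x)] : positive_op (horner_op (p n + e%:P) T).
  apply: horner_op_positive => // t st; rewrite hornerD hornerC.
  have := f0 t st; have : `|(p n).[t] - f t| <= e by move: t st; near: n; exact: pf.
  by rewrite ler_norml => /andP[? ?] ?; lra.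
rewrite horner_opD horner_opC !opE !rinnerE -rnorm_sqr expr2 -/C.
have h3 : e * C <= d / 2.
  rewrite /e mulrAC ler_pdivrMr// -subr_ge0.
  by rewrite [X in 0 <= X](_ : _ = d) ?ltW//; field.
move: h1; rewrite ler_norml => /andP[? ?] ?; lra.
Unshelve. all: by end_near. Qed.

(** Both differences of the two limits represent the zero function, so both are
    positive and their quadratic form vanishes. *)
Lemma is_cfc_unique f T S S' : self_adjoint T -> is_cfc f T S -> is_cfc f T S' -> S = S'.
Proof.
move=> sT hS hS'; apply/eqP; rewrite -subr_eq0; apply/eqP.
have diff S1 S2 : is_cfc f T S1 -> is_cfc f T S2 -> positive_op (S1 - S2).
  move=> h1 /(is_cfcZ (-1)) h2; have := is_cfcD h1 h2.
  rewrite rmorphN1 scaleN1r; apply: is_cfc_ge0 => // t _; lra.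
apply: positive_zero; first exact: diff.
move=> x; apply/eqP; rewrite eq_le.
have /positive_opP[_ /(_ x) ->] := diff _ _ hS hS'.
have /positive_opP[_ /(_ x)] := diff _ _ hS' hS.
by rewrite -(opprB S S') op_oppE rinnerNl oppr_ge0 => ->.
Qed.

(** [horner_op_norm_le] turns uniform convergence on the spectrum into the
    Cauchy property in operator norm. *)
Lemma is_cfc_exists f T : self_adjoint T ->
  (forall e : R, 0 < e -> exists p, forall t : R, spectrum T t%:C -> `|p.[t] - f t| <= e) ->
  exists S, is_cfc f T S.
Proof.
move=> sT appr.
have /choice[p pP] (n : nat) : exists p, forall t : R, spectrum T t%:C ->
    `|p.[t] - f t| <= n.+1%:R^-1 by apply: appr; rewrite invr_gt0.
have pf : spec_approx f T p.
  move=> e e0; have := near_infty_natSinv_lt (PosNum e0).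
  by apply: filterS => n /= h t st; apply: le_trans (pP n t st) (ltW h).
have [S hS] : exists S, op_cvg (fun n => horner_op (p n) T) S.
  apply: op_complete => e e0; have [N _ NP] := pf (e / 2) (divr_gt0 e0 (ltr0n R 2)).
  exists N => m n Nm Nn x.
  have -> : horner_op (p m) T x - horner_op (p n) T x = horner_op (p m + (-1) *: p n) T x.
    by rewrite horner_opD horner_opZ rmorphN1 scaleN1r.
  apply: horner_op_norm_le => //; first exact: ltW.
  move=> t st; rewrite hornerD hornerZ mulN1r.
  have := NP _ Nm t st; have := NP _ Nn t st; rewrite !ler_norml.
  by move=> /andP[? ?] /andP[? ?]; lra.
by exists S; apply/is_cfcP; exists p.
Qed.

Lemma cfc_spec f T : self_adjoint T ->
  (forall e : R, 0 < e -> exists p, forall t : R, spectrum T t%:C -> `|p.[t] - f t| <= e) ->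
  is_cfc f T (cfc f T).
Proof. by move=> sT /(is_cfc_exists sT); exact: xgetPex. Qed.

Lemma is_cfc1 T : is_cfc (fun=> 1) T 1.
Proof.
have := is_cfc_horner 1%:P T; rewrite horner_opC scale1r.
by apply: is_cfc_eq => t _; rewrite hornerC.
Qed.

Lemma is_cfc_id T : is_cfc id T T.
Proof.
have := is_cfc_horner 'X T; rewrite horner_opX.
by apply: is_cfc_eq => t _; rewrite hornerX.
Qed.

Lemma is_cfcB f g T S S' : is_cfc f T S -> is_cfc g T S' ->
  is_cfc (fun t => f t - g t) T (S - S').
Proof.
move=> hf /(is_cfcZ (-1)); rewrite rmorphN1 scaleN1r => hg.
by apply: is_cfc_eq (is_cfcD hf hg) => t _; rewrite mulN1r.
Qed.

Lemma is_cfc_affine T (r : R) :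
  is_cfc (fun t => (1 - r) + r * t) T ((1 - r)%:C *: (1 : 'B(H)) + r%:C *: T).
Proof.
have := is_cfcD (is_cfcZ (1 - r) (is_cfc1 T)) (is_cfcZ r (is_cfc_id T)).
by apply: is_cfc_eq => t _; rewrite mulr1.
Qed.

Lemma is_cfc_sum (I : Type) (s : seq I) (f : I -> R -> R) (F : I -> 'B(H)) T :
  (forall i, is_cfc (f i) T (F i)) ->
  is_cfc (fun t => \sum_(i <- s) f i t) T (\sum_(i <- s) F i).
Proof.
move=> fF; elim: s => [|i s IH].
  rewrite big_nil; have := is_cfcZ 0 (is_cfc1 T); rewrite scale0r.
  by apply: is_cfc_eq => t _; rewrite big_nil mul0r.
rewrite big_cons; have := is_cfcD (fF i) IH.
by apply: is_cfc_eq => t _; rewrite big_cons.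
Qed.

End Calculus.

(** * Real powers and operator means *)

Section Powers.
Context {R : realType} {H : hilbertType R}.
Implicit Types (A B S T : 'B(H)) (x y : H) (r s v : R).

(** Keeping the spectrum away from 0 makes every real power, negative
    exponents included, bounded and Lipschitz on it. *)
Lemma pos_inv_spectrum A : pos_inv_op A -> exists a b, [/\ 0 < a, a < b &
  forall t : R, spectrum A t%:C -> a <= t <= b].
Proof.
move=> [pA iA]; have [a a0 aA] := invertible_positive_def pA iA.
have [M M0 MA] := op_bounded A; exists a, (M + a); split=> //; first by rewrite ltrDr.
move=> t; have [sA _] := pA; apply: spectrum_bounds => // x; rewrite aA /=.
apply: le_trans (rinner_le _ _) _; apply: le_trans (ler_wpM2r (rnorm_ge0 x) (MA x)) _.
by rewrite -mulrA -expr2 ler_wpM2r ?sqr_ge0// lerDl ltW.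
Qed.

Lemma pow_op_cfc A v : pos_inv_op A -> is_cfc (fun t => t `^ v) A (pow_op A v).
Proof.
move=> hA; have [a [b [a0 ab spA]]] := pos_inv_spectrum hA.
have [[sA _] _] := hA; apply: cfc_spec => // e e0.
have [L hL] := powR_lipschitz b v a0.
have [p pP] := weierstrass_lipschitz ab e0 hL.
by exists p => t /spA; exact: pP.
Qed.

Lemma powR_bounded (a b v : R) : 0 < a -> exists C : R,
  forall t, a <= t <= b -> `|t `^ v| <= C.
Proof.
move=> a0; have [L hL] := powR_lipschitz b v a0.
exists (`|a `^ v| + `|L| * (b - a)) => t atb; have /andP[at_ tb] := atb.
have -> : t `^ v = a `^ v + (t `^ v - a `^ v) by rewrite subrKC.
apply: le_trans (ler_normD _ _) _; rewrite lerD2l.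
apply: le_trans (hL t a atb _) _; first by rewrite lexx (le_trans at_).
apply: le_trans (ler_wpM2r (normr_ge0 _) (ler_norm L)) _.
by rewrite ler_wpM2l// ger0_norm ?subr_ge0// lerB.
Qed.

Lemma pow_opD A r s : pos_inv_op A -> pow_op A (r + s) = pow_op A r * pow_op A s.
Proof.
move=> hA; have [a [b [a0 ab spA]]] := pos_inv_spectrum hA.
have [[sA _] _] := hA; apply: is_cfc_unique sA (pow_op_cfc _ hA) _.
have [C hC] := powR_bounded b r a0; have [D hD] := powR_bounded b s a0.
have := @is_cfcM _ _ _ _ _ _ _ (Num.max C D) _ (pow_op_cfc r hA) (pow_op_cfc s hA).
move=> prod; apply: is_cfc_eq (prod _) => t /spA /[dup] tab /andP[at_ _].
  by rewrite powRD// (gt_eqF (lt_le_trans a0 at_)) implybT.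
by rewrite !le_max hC// hD// orbT.
Qed.

Lemma pow_op0 A : pos_inv_op A -> pow_op A 0 = 1.
Proof.
move=> hA; have [[sA _] _] := hA; apply: is_cfc_unique sA (pow_op_cfc _ hA) _.
by apply: is_cfc_eq (is_cfc1 A) => t _; rewrite powRr0.
Qed.

Lemma pow_op1 A : pos_inv_op A -> pow_op A 1 = A.
Proof.
move=> hA; have [a [b [a0 _ spA]]] := pos_inv_spectrum hA.
have [[sA _] _] := hA; apply: is_cfc_unique sA (pow_op_cfc _ hA) _.
apply: is_cfc_eq (is_cfc_id A) => t /spA/andP[at_ _].
by rewrite powRr1// (le_trans _ at_)// ltW.
Qed.

Lemma pow_op_self_adjoint A v : pos_inv_op A -> self_adjoint (pow_op A v).
Proof.
move=> hA; have [[sA _] _] := hA.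
by have [] := is_cfc_ge0 sA (fun t _ => powR_ge0 t v) (pow_op_cfc v hA).
Qed.

Lemma positive_conj S T : self_adjoint S -> positive_op T -> positive_op (S * T * S).
Proof.
move=> sS [sT pT]; split=> [|x]; first exact: self_adjoint_conj.
by rewrite !op_mulE sS.
Qed.

Lemma pos_inv_conj S T : self_adjoint S -> invertible_op S -> pos_inv_op T ->
  pos_inv_op (S * T * S).
Proof.
move=> sS iS [pT iT]; split; first exact: positive_conj.
by do 2?apply: invertible_opM.
Qed.

(** The transfer from numbers to operators, for arbitrary weights g: right side
    minus left side is C Z C, where Z is the function of X
    whose nonnegativity on positive numbers is assumed. *)
Lemma geom_mean_le A B v d (g : nat -> R) n : pos_inv_op A -> pos_inv_op B ->
  (forall t, 0 < t -> (1 - v) + v * t <=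
     t `^ v + (1 - d) * ((1 - 2^-1) + 2^-1 * t - t `^ 2^-1)
     + d * \sum_(2 <= k < n.+1)
         2 ^+ (k - 2) * (t `^ 2^-1 - 2 * t `^ (g k) + t `^ (g k.-1))) ->
  A ∇_[v] B <=o
    A ♮_[v] B + (1 - d)%:C *: (A ∇ B - A ♯ B)
    + d%:C *: \sum_(2 <= k < n.+1) 2 ^+ (k - 2) *:
        (A ♯ B - 2 *: (A ♮_[g k] B) + A ♮_[g k.-1] B).
Proof.
move=> hA hB ineq.
pose C := pow_op A 2^-1; pose D := pow_op A (- 2^-1).
have CD : C * D = 1 by rewrite -pow_opD// subrr pow_op0.
have DC : D * C = 1 by rewrite -pow_opD// addNr pow_op0.
have CC : C * C = A by rewrite -pow_opD// (_ : 2^-1 + 2^-1 = 1) ?pow_op1//; field.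
pose X := D * B * D.
have hX : pos_inv_op X.
  by apply: pos_inv_conj => //; [exact: pow_op_self_adjoint | exists C].
pose K S := C * S * C.
have geomE r : A ♮_[r] B = K (pow_op X r) by [].
have AE : A = K 1 by rewrite /K mulr1 CC.
have BE : B = K X by rewrite /K /X !mulrA CD mul1r -mulrA DC mulr1.
have KD S T : K S + K T = K (S + T) by rewrite /K mulrDr mulrDl.
have KN S : - K S = K (- S) by rewrite /K mulrN mulNr.
have KZ a S : a *: K S = K (a *: S) by rewrite /K op_scaleAr op_scaleAl.
have Ksum (F : nat -> 'B(H)) : \sum_(2 <= k < n.+1) K (F k) = K (\sum_(2 <= k < n.+1) F k).
  by rewrite /K mulr_sumr mulr_suml.
have arithE r : A ∇_[r] B = K ((1 - r)%:C *: (1 : 'B(H)) + r%:C *: X).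
  by rewrite -KD -!KZ -AE -BE.
rewrite /le_op !arithE !geomE.
under eq_bigr do rewrite !geomE KZ KN !KD KZ.
rewrite Ksum KZ !KN !KD KZ !KD.
apply: positive_conj; first exact: pow_op_self_adjoint.
have [[sX _] _] := hX.
have [a [b [a0 _ spX]]] := pos_inv_spectrum hX.
have two k : (2 ^+ k : R[i]) = (2 ^+ k)%:C by rewrite rmorphXn rmorph_nat.
have pX r := pow_op_cfc r hX.
apply: (is_cfc_ge0 sX); last first.
  apply: is_cfcB; last exact: is_cfc_affine.
  apply: is_cfcD; first (apply: is_cfcD; first exact: pX).
    by apply: is_cfcZ; apply: is_cfcB; [exact: is_cfc_affine | exact: pX].
  apply: is_cfcZ; apply: is_cfc_sum => k.
  rewrite two; apply: is_cfcZ; apply: is_cfcD; last exact: pX.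
  apply: is_cfcB; first exact: pX.
  by rewrite -(rmorph_nat (real_complex R)); apply: is_cfcZ; exact: pX.
by move=> t /spX/andP[at_ _]; rewrite subr_ge0; apply: ineq; apply: lt_le_trans at_.
Qed.

End Powers.

Theorem theorem4 (R : realType) (H : hilbertType R) (A B : 'B(H))
    (hA : pos_inv_op A) (hB : pos_inv_op B)
    (n : nat) (hn : (2 <= n)%N) (v : R) (hv : v != 1 / 2) :
  (v \notin `[1 / 2, (2 ^+ n.-1 + 1) / 2 ^+ n] ->
     A ∇_[v] B <=o
       A ♮_[v] B + (2 * (1 - v))%:C *: (A ∇ B - A ♯ B)
       + (2 * v - 1)%:C *: \sum_(2 <= k < n.+1) 2 ^+ (k - 2) *:
           (A ♯ B
            - 2 *: (A ♯_[(2 ^+ k.-1 + 1) / 2 ^+ k] B)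
            + A ♯_[(2 ^+ (k - 2) + 1) / 2 ^+ k.-1] B))
  /\
  (v \notin `[(2 ^+ n.-1 - 1) / 2 ^+ n, 1 / 2] ->
     A ∇_[v] B <=o
       A ♮_[v] B + (2 * v)%:C *: (A ∇ B - A ♯ B)
       + (1 - 2 * v)%:C *: \sum_(2 <= k < n.+1) 2 ^+ (k - 2) *:
           (A ♯ B
            - 2 *: (A ♯_[(2 ^+ k.-1 - 1) / 2 ^+ k] B)
            + A ♯_[(2 ^+ (k - 2) - 1) / 2 ^+ k.-1] B)).
Proof.
have n0 : (0 < n)%N by rewrite ltnW.
have gE (sgn : R) k : (0 < k)%N -> 2^-1 + sgn / 2 ^+ k = (2 ^+ k.-1 + sgn) / 2 ^+ k.
  by case: k => // k _; rewrite /= exprS; field; rewrite expf_neq0.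
have p0 : 0 < (2 : R) ^+ n.-1 by rewrite exprn_gt0.
have nE : (2 : R) ^+ n = 2 * 2 ^+ n.-1 by rewrite -{1}(prednK n0) exprS.
(* The two parts are the cases sgn = 1 and sgn = -1. *)
have main (sgn : R) : sgn = 1 \/ sgn = -1 ->
    sgn * (2 * v - 1) * 2 ^+ n.-1 <= 0 \/ 1 <= sgn * (2 * v - 1) * 2 ^+ n.-1 ->
    A ∇_[v] B <=o
       A ♮_[v] B + (1 - sgn * (2 * v - 1))%:C *: (A ∇ B - A ♯ B)
       + (sgn * (2 * v - 1))%:C *: \sum_(2 <= k < n.+1) 2 ^+ (k - 2) *:
           (A ♯ B
            - 2 *: (A ♯_[(2 ^+ k.-1 + sgn) / 2 ^+ k] B)
            + A ♯_[(2 ^+ (k - 2) + sgn) / 2 ^+ k.-1] B).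
  move=> hs hc.
  have := geom_mean_le hA hB (fun t t0 => refined_young t0 hs n0 hc).
  rewrite (eq_big_nat _ _ (F2 := fun k => 2 ^+ (k - 2) *:
           (A ♯ B - 2 *: (A ♯_[(2 ^+ k.-1 + sgn) / 2 ^+ k] B)
            + A ♯_[(2 ^+ (k - 2) + sgn) / 2 ^+ k.-1] B))) //.
  by move=> [//|[//|k]] _; rewrite !gE// !subSS subn0.
split; rewrite in_itv /= negb_and -!ltNge => hv'.
- have := main 1 (or_introl erefl); rewrite !mul1r.
  have -> : 1 - (2 * v - 1) = 2 * (1 - v) by ring.
  apply; case/orP: hv' => h; [left|right].
    by rewrite pmulr_lle0//; lra.
  by move: h; rewrite ltr_pdivrMr ?nE ?mulr_gt0//; lra.
- have := main (-1) (or_intror erefl); rewrite !mulN1r.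
  have -> : - (2 * v - 1) = 1 - 2 * v by ring.
  have -> : 1 - (1 - 2 * v) = 2 * v by ring.
  apply; case/orP: hv' => h; [right|left].
    by move: h; rewrite ltr_pdivlMr ?nE ?mulr_gt0//; lra.
  by rewrite pmulr_lle0//; lra.
Qed.
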